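(* For any instance of $\mathrm{Max}\text{-}r\text{-}\mathrm{SAT}$ with $n$ variables, one can compute a $(\sqrt{2}/2)$-approximate optimal assignment (an assignment satisfying at least $\sqrt{2}/2$ times the maximum number of simultaneously satisfiable clauses) by a deterministic algorithm in the read-only-input, write-only-output model that runs in time $n^{O(r)}$ and uses $O(r \log n)$ bits of auxiliary space.
   Context: An instance of $\mathrm{Max}\text{-}r\text{-}\mathrm{SAT}$ is a CNF formula $F = C_1 \wedge \dots \wedge C_m$ over variables $x_1,\dots,x_n$, where each clause $C_j$ is a disjunction of at most $r$ literals (variables or their negations). An assignment is a map from $\{x_1,\dots,x_n\}$ to $\{0,1\}$; the goal is to satisfy as many clauses as possible. Model of computation: a RAM in which the input formula is given in a canonical representation with read-only (random) access, the algorithm has read-write access to auxiliary memory whose size is measured in bits, and the output is written to a write-only stream that cannot be read back. Space bounds refer to the number of auxiliary bits used.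
   Formalization: The number of clauses m is assumed at most n^{ar} for an arbitrary constant a, on which the O-constants may depend (automatic for distinct clauses; with unbounded repetitions the time bound fails); r ≥ 1, and n is read as max(n,2) in the bounds. *)

(* Defs.v *)
From mathcomp Require Import all_boot all_order all_algebra.

Set Implicit Arguments.
Unset Strict Implicit.
Unset Printing Implicit Defensive.

(* (i, true) is the literal x_i and (i, false) is its negation. *)
Definition literal (n : nat) := ('I_n * bool)%type.

(* Clauses and formulas are arbitrary sequences: repeated or complementary
   literals in a clause, empty clauses and repeated clauses are all allowed. *)
Definition clause (n : nat) := seq (literal n).
Definition cnf (n : nat) := seq (clause n).

Definition assignment (n : nat) := {ffun 'I_n -> bool}.

Definition lit_true n (x : assignment n) (l : literal n) : bool :=
  x l.1 == l.2.

Definition clause_sat n (x : assignment n) (C : clause n) : bool :=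
  has (lit_true x) C.

Definition nsat n (x : assignment n) (F : cnf n) : nat :=
  count (clause_sat x) F.

Definition max_sat n (F : cnf n) : nat :=
  \max_(x : {ffun 'I_n -> bool}) nsat x F.

Definition width_le (r n : nat) (F : cnf n) : bool :=
  all (fun C => size C <= r) F.

(* n; number of clauses; then, clause by clause, its length followed by the
   codes of its literals: 2i+1 for x_i and 2i for its negation. *)
Definition encode_clause n (C : clause n) : seq nat :=
  size C :: [seq (val l.1).*2 + nat_of_bool l.2 | l <- C].
Definition encode_cnf n (F : cnf n) : seq nat :=
  n :: size F :: flatten [seq encode_clause C | C <- F].

Definition encode_assignment n (x : assignment n) : seq bool :=
  [seq x i | i <- enum 'I_n].

Inductive arith_op := Add | Sub | Mul | Div | Mod.

(* Random access machine.  d, s, s1, s2 are addresses of auxiliary memory cells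
   and l is a program position; LoadInd and StoreInd address indirectly, and Read
   takes the input position from a memory cell.  There is no instruction that
   writes the input or reads the output. *)
Inductive instr :=
  | Const (d k : nat)
  | Arith (o : arith_op) (d s1 s2 : nat)
  | LoadInd (d s : nat)
  | StoreInd (d s : nat)
  | Read (d s : nat)
  | Write (s : nat)
  | Jump (l : nat)
  | JumpZ (s l : nat)
  | Halt.

Definition program := seq instr.

Definition arith (o : arith_op) (u v : nat) : nat :=
  match o with
  | Add => u + v
  | Sub => u - v
  | Mul => u * v
  | Div => u %/ v
  | Mod => u %% v
  end.

(* The memory is the list of all cells up to the largest address written so
   far; it grows by zero-padding (set_nth) and never shrinks.  Cells beyond it
   read as 0, and so do input cells beyond the end of the input. *)
Record config := Config {
  pc : nat;
  mem : seq nat;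
  out : seq bool
}.

Definition init_config : config := Config 0 [::] [::].

Definition cell (c : config) (a : nat) : nat := nth 0 (mem c) a.

Definition assign (c : config) (a v : nat) : config :=
  Config (pc c).+1 (set_nth 0 (mem c) a v) (out c).

Definition goto (c : config) (l : nat) : config := Config l (mem c) (out c).

Definition fetch (P : program) (c : config) : instr := nth Halt P (pc c).

Definition step (P : program) (inp : seq nat) (c : config) : config :=
  match fetch P c with
  | Const d k => assign c d k
  | Arith o d s1 s2 => assign c d (arith o (cell c s1) (cell c s2))
  | LoadInd d s => assign c d (cell c (cell c s))
  | StoreInd d s => assign c (cell c d) (cell c s)
  | Read d s => assign c d (nth 0 inp (cell c s))
  | Write s => Config (pc c).+1 (mem c) (rcons (out c) (cell c s != 0))
  | Jump l => goto c l
  | JumpZ s l => if cell c s == 0 then goto c l else goto c (pc c).+1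
  | Halt => c
  end.

Definition halted (P : program) (c : config) : bool :=
  if fetch P c is Halt then true else false.

Definition run (P : program) (inp : seq nat) (t : nat) : config :=
  iter t (step P inp) init_config.

(* Length of the binary numeral of v, with bit_length 0 = 1. *)
Definition bit_length (v : nat) : nat := (trunc_log 2 v).+1.

(* Every cell below the largest address written is charged at least one bit,
   so nothing can be stored for free in the choice of an address. *)
Definition space (c : config) : nat := \sum_(v <- mem c) bit_length v.

Definition computes_within (P : program) (inp : seq nat) (o : seq bool)
    (T S : nat) : Prop :=
  exists t : nat,
    [/\ t <= T, halted P (run P inp t), out (run P inp t) = o
      & forall s : nat, s <= t -> space (run P inp s) <= S].

(* With repetitions the number of clauses is not bounded in terms of n and r;
   without them it is n^{O(r)}. *)
Lemma size_uniq_cnf (r n : nat) (F : cnf n) :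
  uniq F -> width_le r F -> size F <= maxn n 2 ^ (3 * r).
Proof.
move=> uF /allP wF; set N := maxn n 2.
have N2 : 2 <= N by rewrite leq_maxr.
have nN : 2 * n <= N ^ 2 by rewrite leq_mul // leq_maxl.
pose f (b : {bseq r of literal n}) : clause n := b.
have sub : {subset F <= [seq f b | b <- enum {: {bseq r of literal n}}]}.
  move=> C /wF Cr; apply/mapP; exists (Bseq Cr) => //; exact: mem_enum.
apply: leq_trans (uniq_leq_size uF sub) _.
rewrite size_map -cardE card_bseq card_prod card_ord card_bool mulnC.
apply: (@leq_trans (\sum_(i < r.+1) N ^ (2 * i))).
  by apply: leq_sum => i _; rewrite expnM; case: (val i) => // k; rewrite leq_exp2r.
elim: r {wF f sub} => [|r IH]; first by rewrite big_ord_recr big_ord0.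
rewrite big_ord_recr /=; apply: leq_trans (leq_add IH (leqnn _)) _.
have N0 : 0 < N by apply: leq_trans N2.
apply: (@leq_trans (N ^ (3 * r + 2) + N ^ (3 * r + 2))).
  by rewrite leq_add // leq_pexp2l // ?leq_addr // mulnS addnC leq_add2r leq_mul.
have -> : 3 * r.+1 = (3 * r + 2).+1 by rewrite mulnS addnC -addnS.
by rewrite addnn -mul2n expnS leq_mul.
Qed.

(* Main.v *)
Require Import Defs.
From mathcomp Require Import all_boot all_order all_algebra.
From mathcomp Require Import zify ring lra.

Set Implicit Arguments.
Unset Strict Implicit.
Unset Printing Implicit Defensive.

(** Call a literal of x_i positive if it agrees with the majority value of x_i,
    where a clause with 1, 2, 3 or more distinct literals votes for each of them
    with weight d = 1, 1/2, 1/4 or 0.  Suppose every variable takes its majority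
    value with probability p = sqrt 2 / 2.  A clause with k positive literals is
    then satisfied with probability at least p + (sqrt 2 - 1) d (k - 1).  Any
    assignment y satisfies p [y satisfies C] <= p + (sqrt 2 - 1) d (T - 1), T
    being the number of literals of C true under y, and the sum of d T is
    largest, equal to that of d k, at the majority assignment; so the expected
    number of satisfied clauses is at least p times the optimum.

    The distribution is replaced by a family of polynomial size: x_i takes its
    majority value iff h i < t, for a cubic polynomial h over F_q, with q prime
    and n < q = O(n^2).  The irrational p is obtained exactly as a mixture of two
    consecutive thresholds t.  This makes the values of two variables positively
    correlated, by O(1 / q^2), and the bound is tight for clauses with two
    literals of the same sign; mixing in a small proportion of nonconstant
    linear h, for which values at distinct points are distinct, more than
    compensates.  All other clauses with at least two literals have slack.

    The machine tries all seeds (q, t, h), recomputing majorities on the fly, and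
    outputs the assignment of the best one.  Its program is compiled from a small
    language whose only loops are bounded sums, so that values and running times
    are polynomially bounded by a syntactic criterion. *)

(** * A language of bounded sums and its compiler *)

(* Variables are de Bruijn indices.  [Acc b e] starts from 0 and adds the value
   of [e] for each i < b; in [e], index 0 is i and index 1 is the running total. *)
Inductive expr :=
  | Var (i : nat)
  | Cst (k : nat)
  | Op (o : arith_op) (a b : expr)
  | Inp (a : expr)
  | Let (a b : expr)
  | Acc (b e : expr).

Fixpoint eval (inp env : seq nat) (e : expr) : nat :=
  match e with
  | Var i => nth 0 env i
  | Cst k => k
  | Op o a b => arith o (eval inp env a) (eval inp env b)
  | Inp a => nth 0 inp (eval inp env a)
  | Let a b => eval inp (eval inp env a :: env) b
  | Acc b e =>
      iteri (eval inp env b) (fun i acc => acc + eval inp [:: i, acc & env] e) 0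
  end.

(* Cell k holds the bound, k + 1 the counter, k + 2 is left to the body and
   k + 3 is scratch. *)
Definition loop (k p : nat) (body : program) : program :=
  [:: Arith Defs.Sub (k + 3) k (k + 1); JumpZ (k + 3) (p + size body + 5)] ++ body
  ++ [:: Const (k + 3) 1; Arith Add (k + 1) (k + 1) (k + 3); Jump p].

(* Code at position p which stores the value in cell k, uses only cells from k
   on, and finds variable i in cell [nth 0 g i]. *)
Fixpoint compile (g : seq nat) (k p : nat) (e : expr) : program :=
  match e with
  | Var i => [:: Const k 0; Arith Add k (nth 0 g i) k]
  | Cst v => [:: Const k v]
  | Op o a b =>
      let ca := compile g k p a in
      ca ++ compile g (k + 1) (p + size ca) b ++ [:: Arith o k k (k + 1)]
  | Inp a => compile g k p a ++ [:: Read k k]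
  | Let a b =>
      let ca := compile g k p a in
      ca ++ compile (k :: g) (k + 1) (p + size ca) b
      ++ [:: Const k 0; Arith Add k (k + 1) k]
  | Acc b e =>
      let cb := compile g k p b in
      let p' := p + size cb in
      cb ++ [:: Const (k + 1) 0; Const (k + 2) 0]
      ++ loop k (p' + 2) (compile [:: k + 1, k + 2 & g] (k + 3) (p' + 4) e
                          ++ [:: Arith Add (k + 2) (k + 2) (k + 3)])
      ++ [:: Arith Add k (k + 2) (k + 3)]
  end.

(* Exponents d such that values and running times are at most X ^ d, when the
   variables are bounded by the powers of X listed in r. *)
Fixpoint deg (r : seq nat) (e : expr) : nat :=
  match e with
  | Var i => nth 0 r i
  | Cst k => up_log 2 k
  | Op Add a b => (maxn (deg r a) (deg r b)).+1
  | Op Mul a b => deg r a + deg r b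
  | Op _ a _ => deg r a
  | Inp _ => 1
  | Let a b => deg (deg r a :: r) b
  | Acc b e => let db := deg r b in db + deg [:: db, 0 & r] e
  end.

Fixpoint time_deg (r : seq nat) (e : expr) : nat :=
  match e with
  | Var _ => 1
  | Cst _ => 0
  | Op _ a b => maxn (time_deg r a) (time_deg r b) + 2
  | Inp a => time_deg r a + 1
  | Let a b => maxn (time_deg r a) (time_deg (deg r a :: r) b) + 2
  | Acc b e =>
      let db := deg r b in
      maxn (time_deg r b)
        (db + time_deg [:: db, db + deg [:: db, 0 & r] e & r] e + 3) + 3
  end.

(* For [Acc] this requires that the degree of the increment does not grow with
   the running total. *)
Fixpoint deg_ok (K : nat) (r : seq nat) (e : expr) : bool :=
  match e with
  | Var i => (i < size r) && (nth 0 r i <= K)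
  | Cst k => up_log 2 k <= K
  | Op o a b => [&& deg_ok K r a, deg_ok K r b & deg r (Op o a b) <= K]
  | Inp a => deg_ok K r a && (0 < K)
  | Let a b => deg_ok K r a && deg_ok K (deg r a :: r) b
  | Acc b e =>
      let db := deg r b in
      let de := deg [:: db, 0 & r] e in
      let r' := [:: db, db + de & r] in
      [&& deg_ok K r b, deg_ok K r' e, deg r' e <= de & db + de <= K]
  end.

(** * Values bounded by powers of X *)

Section Bounds.

Variables (inp : seq nat) (X : nat).
Hypotheses (X_ge2 : 2 <= X) (inp_le : forall i, nth 0 inp i <= X).

Definition bounded (r env : seq nat) : Prop :=
  size r = size env /\ forall i, nth 0 env i <= X ^ nth 0 r i.

Lemma bounded_cons r env d v : v <= X ^ d -> bounded r env -> bounded (d :: r) (v :: env).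
Proof. by move=> v_le [size_r env_le]; split=> [|[|i]] //=; rewrite size_r. Qed.

Lemma leq_pow d d' : d <= d' -> X ^ d <= X ^ d'.
Proof. by move=> le_d; rewrite leq_pexp2l //; apply: ltnW. Qed.

Lemma pow_gt0 d : 0 < X ^ d.
Proof. by rewrite expn_gt0 ltnW. Qed.

Lemma cst_le_pow k : k <= X ^ up_log 2 k.
Proof. by apply: leq_trans (up_logP k (ltnSn 1)) _; case: up_log => // d; rewrite leq_exp2r. Qed.

Lemma arith_le_pow o u v du dv : u <= X ^ du -> v <= X ^ dv ->
  arith o u v <= X ^ match o with
    | Add => (maxn du dv).+1 | Mul => du + dv | _ => du end.
Proof.
move=> u_le v_le; case: o => /=.
- rewrite expnS; apply: (@leq_trans (2 * X ^ maxn du dv)); last by rewrite leq_mul.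
  rewrite mul2n -addnn leq_add //.
    by apply: leq_trans u_le _; rewrite leq_pow ?leq_maxl.
  by apply: leq_trans v_le _; rewrite leq_pow ?leq_maxr.
- by apply: leq_trans u_le; apply: leq_subr.
- by rewrite expnD leq_mul.
- by apply: leq_trans u_le; apply: leq_div.
- by apply: leq_trans u_le; apply: leq_mod.
Qed.

(** The increment is controlled only while the total is at most X ^ (db + de). The induction closes
    because j increments of at most X ^ de stay below that bound as long as j <= X ^ db. *)
Lemma acc_le_pow db de B j (f : nat -> nat -> nat) :
  (forall i acc, i < B -> acc <= X ^ (db + de) -> f i acc <= X ^ de) ->
  B <= X ^ db -> j <= B ->
  iteri j (fun i acc => acc + f i acc) 0 <= j * X ^ de.
Proof.
move=> f_le B_le; elim: j => //= j IH j_lt; rewrite mulSnr leq_add ?IH ?(ltnW j_lt) //.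
apply: f_le => //; apply: leq_trans (IH (ltnW j_lt)) _.
by rewrite expnD leq_mul // (leq_trans (ltnW j_lt)).
Qed.

Lemma eval_le_pow K e r env : deg_ok K r e -> bounded r env -> eval inp env e <= X ^ deg r e.
Proof.
elim: e r env => [i|k|o a IHa b IHb|a IHa|a IHa b IHb|b IHb e IHe] r env /=.
- by move=> _ [].
- by move=> _ _; apply: cst_le_pow.
- case/and3P=> ok_a ok_b _ bnd.
  have := arith_le_pow o (IHa _ _ ok_a bnd) (IHb _ _ ok_b bnd).
  by case: o.
- by move=> _ _; rewrite expn1.
- case/andP=> ok_a ok_b bnd; apply: IHb => //; apply: bounded_cons => //.
  exact: IHa.
- case/and4P=> ok_b ok_e le_de _ bnd; have B_le := IHb _ _ ok_b bnd.
  apply: (@leq_trans (eval inp env b * X ^ deg [:: deg r b, 0 & r] e)); last first.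
    by rewrite expnD leq_mul.
  apply: acc_le_pow (B_le) (leqnn _) => i acc i_lt acc_le.
  (* The body is bounded with the true degree db + de of the running total; [le_de] brings this back
     to the degree computed with the placeholder 0. *)
  apply: leq_trans (leq_pow le_de); apply: IHe ok_e _.
  apply: bounded_cons; first exact: leq_trans (ltnW i_lt) B_le.
  exact: bounded_cons.
Qed.

End Bounds.

(** * Symbolic execution of the machine *)

Section Machine.

Variables (P : program) (inp : seq nat) (V : nat).

Definition safe (m : seq nat) : Prop := forall a, nth 0 m a <= V.

(** Safety is demanded of every intermediate configuration, because the space bound concerns the
    whole run. *)
Definition runs (T : nat) (c c' : config) : Prop :=
  exists2 t, t <= T & iter t (step P inp) c = c'
    /\ forall s, s <= t -> safe (Defs.mem (iter s (step P inp) c)).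

Definition code_at (p : nat) (C : program) : Prop :=
  forall i, i < size C -> nth Halt P (p + i) = nth Halt C i.

Lemma code_at_cat p C1 C2 :
  code_at p (C1 ++ C2) -> code_at p C1 /\ code_at (p + size C1) C2.
Proof.
move=> at_p; split=> i i_lt.
  by rewrite at_p ?size_cat ?ltn_addr // nth_cat i_lt.
by rewrite -addnA at_p ?size_cat ?ltn_add2l // nth_cat ltnNge leq_addr addKn.
Qed.

Lemma code_at_cons p i C : code_at p (i :: C) -> nth Halt P p = i /\ code_at p.+1 C.
Proof.
by move=> /(@code_at_cat p [:: i]) [/(_ 0 isT)]; rewrite addn0 addn1.
Qed.

Lemma runs_refl c : safe (Defs.mem c) -> runs 0 c c.
Proof. by exists 0 => //; split=> // s; rewrite leqn0 => /eqP ->. Qed.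

Lemma runs_le T T' c c' : T <= T' -> runs T c c' -> runs T' c c'.
Proof. by move=> le_T [t t_le ok]; exists t => //; apply: leq_trans le_T. Qed.

Lemma runs_safe T c c' : runs T c c' -> safe (Defs.mem c').
Proof. by case=> t _ [<-]; apply. Qed.

Lemma runs_trans T1 T2 c1 c2 c3 : runs T1 c1 c2 -> runs T2 c2 c3 -> runs (T1 + T2) c1 c3.
Proof.
move=> [t1 le1 [run1 safe1]] [t2 le2 [run2 safe2]]; exists (t2 + t1).
  by rewrite addnC leq_add.
split=> [|s s_le]; first by rewrite iterD run1.
case: (leqP s t1) => [/safe1//|lt_s].
by rewrite -(subnK (ltnW lt_s)) iterD run1; apply: safe2; rewrite leq_subLR addnC.
Qed.

Lemma runs_step T c c' : safe (Defs.mem c) -> runs T (step P inp c) c' -> runs T.+1 c c'.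
Proof.
move=> safe_c [t t_le [run_t safe_t]]; exists t.+1 => //; split=> [|s]; first by rewrite iterSr.
by case: s => [|s] //; rewrite ltnS iterSr; apply: safe_t.
Qed.

Lemma nth_set (m : seq nat) a v b : nth 0 (set_nth 0 m a v) b = if b == a then v else nth 0 m b.
Proof. by rewrite nth_set_nth /=. Qed.

Lemma safe_set m a v : safe m -> v <= V -> safe (set_nth 0 m a v).
Proof. by move=> safe_m v_le b; rewrite nth_set; case: ifP. Qed.

Section Steps.

Variables (T : nat) (p : nat) (m : seq nat) (o : seq bool) (c : config).
Hypothesis safe_m : safe m.

Lemma runs_const d v : nth Halt P p = Const d v ->
  runs T (Config p.+1 (set_nth 0 m d v) o) c -> runs T.+1 (Config p m o) c.
Proof. by move=> at_p run_c; apply: runs_step => //; rewrite /step /fetch /= at_p. Qed.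

Lemma runs_arith op d a b : nth Halt P p = Arith op d a b ->
  runs T (Config p.+1 (set_nth 0 m d (arith op (nth 0 m a) (nth 0 m b))) o) c ->
  runs T.+1 (Config p m o) c.
Proof. by move=> at_p run_c; apply: runs_step => //; rewrite /step /fetch /= at_p. Qed.

Lemma runs_read d a : nth Halt P p = Read d a ->
  runs T (Config p.+1 (set_nth 0 m d (nth 0 inp (nth 0 m a))) o) c ->
  runs T.+1 (Config p m o) c.
Proof. by move=> at_p run_c; apply: runs_step => //; rewrite /step /fetch /= at_p. Qed.

Lemma runs_write a : nth Halt P p = Write a ->
  runs T (Config p.+1 m (rcons o (nth 0 m a != 0))) c -> runs T.+1 (Config p m o) c.
Proof. by move=> at_p run_c; apply: runs_step => //; rewrite /step /fetch /= at_p. Qed.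

Lemma runs_jump l : nth Halt P p = Jump l ->
  runs T (Config l m o) c -> runs T.+1 (Config p m o) c.
Proof. by move=> at_p run_c; apply: runs_step => //; rewrite /step /fetch /= at_p. Qed.

Lemma runs_jumpz a l : nth Halt P p = JumpZ a l ->
  runs T (Config (if nth 0 m a == 0 then l else p.+1) m o) c ->
  runs T.+1 (Config p m o) c.
Proof.
move=> at_p run_c; apply: runs_step => //; rewrite /step /fetch /= at_p /cell /=.
by case: ifP run_c.
Qed.

End Steps.

(* [J i] is the invariant before the iteration with counter i; the cells k, k + 1
   and k + 3 belong to the loop. *)
Lemma loop_runs k p body B (J : nat -> seq nat -> seq bool -> Prop) T m o :
  0 < V ->
  code_at p (loop k p body) ->
  (forall i m1 m2 o1, (forall a, a < k + 3 -> a != k + 1 -> nth 0 m2 a = nth 0 m1 a) ->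
     J i m1 o1 -> J i m2 o1) ->
  (forall i m1 o1, i < B -> safe m1 -> nth 0 m1 k = B -> nth 0 m1 (k + 1) = i ->
     J i m1 o1 -> exists m2 o2,
       [/\ runs T (Config (p + 2) m1 o1) (Config (p + 2 + size body) m2 o2),
           nth 0 m2 k = B, nth 0 m2 (k + 1) = i & J i.+1 m2 o2]) ->
  safe m -> nth 0 m k = B -> nth 0 m (k + 1) = 0 -> J 0 m o ->
  exists m' o',
    [/\ runs (B * (T + 5) + 2) (Config p m o) (Config (p + size body + 5) m' o'),
        nth 0 m' (k + 3) = 0 & J B m' o'].
Proof.
move=> V_gt0 code_p J_ext J_body safe_m m_k m_i J0.
have [at0 /code_at_cons[at1 /code_at_cat[_ code3]]] := code_at_cons code_p.
rewrite -[p.+2]addn2 in code3.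
have {code3}[at2 /code_at_cons[at3 /code_at_cons[at4 _]]] := code_at_cons code3.
have neq31 : (k + 1 == k + 3) = false by lia.
have neq03 : (k == k + 3) = false by lia.
have neq01 : (k == k + 1) = false by lia.
have V_ge i : nth 0 m k - i <= V by apply: leq_trans (leq_subr _ _) (safe_m k).
rewrite m_k in V_ge.
suff run_from r : forall i m1 o1, r = B - i -> i <= B -> safe m1 -> nth 0 m1 k = B ->
    nth 0 m1 (k + 1) = i -> J i m1 o1 -> exists m' o',
      [/\ runs (r * (T + 5) + 2) (Config p m1 o1) (Config (p + size body + 5) m' o'),
        nth 0 m' (k + 3) = 0 & J B m' o'].
  by apply: run_from m_i J0; rewrite ?subn0.
elim: r {m o safe_m m_k m_i J0} => [|r IH] i m o rE i_le safe_m m_k m_i Ji.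
  have {i_le} i_eq : i = B by lia.
  exists (set_nth 0 m (k + 3) 0), o; rewrite nth_set eqxx; split=> //.
    rewrite mul0n; apply: (runs_arith safe_m at0); rewrite /= m_k m_i -rE.
    have safe1 : safe (set_nth 0 m (k + 3) 0) by apply: safe_set.
    apply: (runs_jumpz safe1 at1); rewrite nth_set eqxx /=.
    exact: runs_refl.
  by rewrite -i_eq; apply: J_ext Ji => a a_lt _; rewrite nth_set ltn_eqF.
have i_lt : i < B by rewrite -subn_gt0 -rE.
set m1 := set_nth 0 m (k + 3) (B - i).
have safe1 : safe m1 by apply: safe_set.
have [|||m2 [o2 [run2 m2_k m2_i J2]]] := J_body i m1 o i_lt safe1.
- by rewrite nth_set neq03.
- by rewrite nth_set neq31.
- by apply: J_ext Ji => a a_lt _; rewrite nth_set ltn_eqF.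
have safe2 := runs_safe run2.
set m3 := set_nth 0 m2 (k + 3) 1; set m4 := set_nth 0 m3 (k + 1) (i + 1).
have safe3 : safe m3 by apply: safe_set.
have safe4 : safe m4.
  by apply: safe_set => //; rewrite addn1; apply: leq_trans i_lt _; rewrite -(subn0 B).
have [||||m' [o' [run' m'_3 J']]] := IH i.+1 m4 o2 _ i_lt safe4.
- by rewrite subnS -rE.
- by rewrite !nth_set neq01 neq03.
- by rewrite nth_set eqxx addn1.
- apply: J_ext J2 => a a_lt a_neq; rewrite !nth_set (negbTE a_neq) ltn_eqF //.
exists m', o'; split=> //; rewrite mulSn.
(* A round costs two instructions before the body and three after it; the last 2 is the final test,
   which leaves the loop. *)
apply: (@runs_le (2 + (T + (3 + (r * (T + 5) + 2))))); first by lia.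
apply: (runs_arith safe_m at0); rewrite /= m_k m_i -/m1.
apply: (runs_jumpz safe1 at1); rewrite nth_set eqxx -rE /= -[p.+2]addn2.
apply: (runs_trans run2).
apply: (runs_const safe2 at2); rewrite -/m3.
apply: (runs_arith safe3 at3); rewrite /= !nth_set eqxx neq31 m2_i -/m4.
exact: (runs_jump safe4 at4 run').
Qed.

End Machine.

(** * Correctness of the compiler *)

Section Compiler.

Variables (P : program) (inp : seq nat) (X K : nat).
Hypotheses (X_ge2 : 2 <= X) (inp_le : forall i, nth 0 inp i <= X).

Local Notation runs := (runs P inp (X ^ K)).
Local Notation safe := (safe (X ^ K)).
Local Notation code_at := (code_at P).

Definition agree (k : nat) (m m' : seq nat) : Prop :=
  forall a, a < k -> nth 0 m' a = nth 0 m a.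

Definition models (g env : seq nat) (k : nat) (m : seq nat) : Prop :=
  size g = size env /\
  forall i, i < size g -> nth 0 g i < k /\ nth 0 m (nth 0 g i) = nth 0 env i.

Lemma models_agree g env k k' m m' :
  k <= k' -> agree k m m' -> models g env k m -> models g env k' m'.
Proof.
move=> le_k agr [size_g mod_m]; split=> // i /mod_m [lt_k <-]; split; last exact: agr.
exact: leq_trans lt_k le_k.
Qed.

Lemma models_cons g env k m a : 
  a < k -> models g env k m -> models (a :: g) (nth 0 m a :: env) k m.
Proof. by move=> a_lt [size_g mod_m]; split=> [|[|i]] //=; [rewrite size_g | apply: mod_m]. Qed.

Lemma agree_trans k k' m m' m'' : k <= k' -> agree k m m' -> agree k' m' m'' -> agree k m m''.
Proof. by move=> le_k agr agr' a a_lt; rewrite agr' ?agr // (leq_trans a_lt). Qed.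

Lemma agree_set k m a v : k <= a -> agree k m (set_nth 0 m a v).
Proof. by move=> le_k b b_lt; rewrite nth_set ltn_eqF // (leq_trans b_lt). Qed.

(** Induction on the expression. The frame condition [agree k] keeps the variables intact, and lets
    a first operand survive in cell k while the second is computed from cell k + 1 on. *)
Lemma compile_runs e : forall g k p r env m o,
  deg_ok K r e -> bounded X r env -> code_at p (compile g k p e) ->
  models g env k m -> safe m ->
  exists m',
    [/\ runs (X ^ time_deg r e) (Config p m o) (Config (p + size (compile g k p e)) m' o),
        agree k m m' & nth 0 m' k = eval inp env e].
Proof.
have le_pow := leq_pow X_ge2.
have pow_gt0 := pow_gt0 X_ge2.
have safe_pow m a v d : safe m -> v <= X ^ d -> d <= K -> safe (set_nth 0 m a v).
  by move=> safe_m v_le d_le; apply: safe_set => //; apply: leq_trans v_le (le_pow _ _ d_le).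
have lt_k k : k < k + 1 by rewrite addn1.
have refl_pc p1 p2 m o : safe m -> p1 = p2 -> runs 0 (Config p1 m o) (Config p2 m o).
  by move=> safe_m <-; apply: runs_refl.
(* The factor X ^ 2 >= 4 pays for two subcomputations and up to two more instructions. *)
have time_max d1 d2 k : k <= 2 -> X ^ d1 + (X ^ d2 + k) <= X ^ (maxn d1 d2 + 2).
  move=> k_le; rewrite expnD; set M := maxn _ _.
  have : X ^ d1 <= X ^ M by rewrite le_pow ?leq_maxl.
  have : X ^ d2 <= X ^ M by rewrite le_pow ?leq_maxr.
  have := pow_gt0 M; have : 4 <= X ^ 2 by rewrite (@leq_exp2r 2 X 2).
  nia.
elim: e => [i|v|op a IHa b IHb|a IHa|a IHa b IHb|b IHb e IHe] g k p r env m o /=.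
- case/andP=> i_lt i_le [size_r env_le] code [size_g mod_m] safe_m.
  have [at0 /code_at_cons[at1 _]] := code_at_cons code.
  have [|lt_gk val_i] := mod_m i; first by rewrite size_g -size_r.
  set m1 := set_nth 0 m k 0.
  have safe1 : safe m1 by apply: safe_set.
  have val1 : nth 0 m1 (nth 0 g i) + nth 0 m1 k = nth 0 env i.
    by rewrite !nth_set eqxx addn0 ltn_eqF // val_i.
  exists (set_nth 0 m1 k (nth 0 env i)); split.
  + apply: (@runs_le _ _ _ 2); first by rewrite expn1.
    apply: (runs_const safe_m at0); apply: (runs_arith safe1 at1); rewrite /= val1 addn2.
    apply: runs_refl; exact: safe_pow (env_le i) _.
  + by apply: agree_trans (leqnn k) _ _; apply: agree_set.
  + by rewrite nth_set eqxx.
- move=> v_le _ code _ safe_m; have [at0 _] := code_at_cons code.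
  exists (set_nth 0 m k v); split; last by rewrite nth_set eqxx.
    rewrite expn0 addn1; apply: (runs_const safe_m at0); apply: runs_refl.
    exact: safe_pow (cst_le_pow X_ge2 v) _.
  exact: agree_set.
- case/and3P=> ok_a ok_b deg_le bnd code mod_m safe_m.
  have [code_a /code_at_cat[code_b code_op]] := code_at_cat code.
  have [at_op _] := code_at_cons code_op.
  have [m1 [run1 agr1 val1]] := IHa _ _ _ _ _ m o ok_a bnd code_a mod_m safe_m.
  have mod1 : models g env (k + 1) m1 by apply: models_agree mod_m; rewrite ?leq_addr.
  have [m2 [run2 agr2 val2]] := IHb _ _ _ _ _ m1 o ok_b bnd code_b mod1 (runs_safe run1).
  set v := arith op (eval inp env a) (eval inp env b).
  exists (set_nth 0 m2 k v); split; last by rewrite nth_set eqxx.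
    apply: (@runs_le _ _ _ (X ^ time_deg r a + (X ^ time_deg r b + 1))).
      by apply: time_max.
    apply: (runs_trans run1); apply: (runs_trans run2).
    apply: (runs_arith (runs_safe run2) at_op).
    rewrite (agr2 k) ?lt_k // val1 val2 -/v !size_cat /=.
    apply: refl_pc; last by lia.
    apply: (safe_pow _ _ _ _ _ _ deg_le); first exact: runs_safe run2.
    apply: (@eval_le_pow inp X X_ge2 inp_le K (Op op a b)) => //.
    by rewrite /= ok_a ok_b.
  apply: (agree_trans (leqnn k) agr1); apply: (agree_trans (leqnn k) _ (agree_set _ _ (leqnn k))).
  by move=> c c_lt; apply: agr2; apply: ltn_addr.
- case/andP=> ok_a K_gt0 bnd code mod_m safe_m.
  have [code_a code_op] := code_at_cat code; have [at_op _] := code_at_cons code_op.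
  have [m1 [run1 agr1 val1]] := IHa _ _ _ _ _ m o ok_a bnd code_a mod_m safe_m.
  exists (set_nth 0 m1 k (nth 0 inp (eval inp env a))); split; last by rewrite nth_set eqxx.
    apply: (@runs_le _ _ _ (X ^ time_deg r a + 1)).
      by rewrite expnD expn1; have := pow_gt0 (time_deg r a); nia.
    apply: (runs_trans run1); apply: (runs_read (runs_safe run1) at_op).
    rewrite val1 size_cat /= addn1 addnS.
    apply: runs_refl; apply: (@safe_pow _ _ _ 1) => //; first exact: runs_safe run1.
  exact: agree_trans (leqnn k) agr1 (agree_set _ _ (leqnn k)).
- case/andP=> ok_a ok_b bnd code mod_m safe_m.
  have [code_a /code_at_cat[code_b code_mv]] := code_at_cat code.
  have [at0 /code_at_cons[at1 _]] := code_at_cons code_mv.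
  have [m1 [run1 agr1 val1]] := IHa _ _ _ _ _ m o ok_a bnd code_a mod_m safe_m.
  have mod1 : models (k :: g) (eval inp env a :: env) (k + 1) m1.
    rewrite -val1; apply: models_cons; rewrite ?lt_k //.
    by apply: models_agree mod_m; rewrite ?leq_addr.
  have bnd1 : bounded X (deg r a :: r) (eval inp env a :: env).
    by apply: bounded_cons (bnd); apply: (eval_le_pow X_ge2 inp_le ok_a).
  have [m2 [run2 agr2 val2]] := IHb _ _ _ _ _ m1 o ok_b bnd1 code_b mod1 (runs_safe run1).
  have safe2 := runs_safe run2.
  set v := eval inp _ b in val2 *; set m3 := set_nth 0 m2 k 0.
  have safe3 : safe m3 by apply: safe_set.
  have val3 : nth 0 m3 (k + 1) + nth 0 m3 k = v.
    by rewrite !nth_set eqxx addn0 gtn_eqF ?lt_k.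
  exists (set_nth 0 m3 k v); split; last by rewrite nth_set eqxx.
    apply: (@runs_le _ _ _ (X ^ time_deg r a + (X ^ time_deg (deg r a :: r) b + 2))).
      by apply: time_max; lia.
    apply: (runs_trans run1); apply: (runs_trans run2).
    apply: (runs_const safe2 at0); apply: (runs_arith safe3 at1).
    rewrite /= val3 !size_cat /=; apply: refl_pc; last by lia.
    by apply: safe_set => //; rewrite -val2; apply: safe2.
  apply: (agree_trans (leqnn k) agr1).
  apply: (agree_trans (k' := k) (m' := m2)) => //.
    by move=> c c_lt; apply: agr2; apply: ltn_addr.
  by apply: (agree_trans (leqnn k)) (agree_set _ _ (leqnn k)) (agree_set _ _ (leqnn k)).
- case/and4P=> ok_b ok_e le_de le_K bnd code mod_m safe_m.
  have [code_b] := code_at_cat code; set mb := size (compile g k p b).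
  set body := (compile _ _ _ e ++ _) => /code_at_cons[at0 /code_at_cons[at1]].
  case/(@code_at_cat _ _ (loop k (p + mb + 2) body)) => code_loop code_mv.
  have [at2 _] := code_at_cons code_mv.
  have [m1 [run1 agr1 val1]] := IHb _ _ _ _ _ m o ok_b bnd code_b mod_m safe_m.
  set B := eval inp env b in val1 *.
  set F := fun i acc => acc + eval inp [:: i, acc & env] e.
  set db := deg r b in ok_e le_de le_K *; set de := deg [:: db, 0 & r] e in ok_e le_de le_K *.
  set r' := [:: db, db + de & r] in ok_e le_de *.
  rewrite -/mb in run1; rewrite -[(p + mb).+2]addn2 in code_loop.
  have B_le : B <= X ^ db := eval_le_pow X_ge2 inp_le ok_b bnd.
  have e_le i acc : i < B -> acc <= X ^ (db + de) ->
      bounded X r' [:: i, acc & env] /\ eval inp [:: i, acc & env] e <= X ^ de.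
    move=> i_lt acc_le; have bnd' : bounded X r' [:: i, acc & env].
      by apply: bounded_cons; [apply: leq_trans (ltnW i_lt) B_le | apply: bounded_cons].
    split=> //; apply: leq_trans (le_pow _ _ le_de).
    exact: eval_le_pow ok_e bnd'.
  have total_le i : i <= B -> iteri i F 0 <= X ^ (db + de).
    move=> i_le; have f_le i' acc : i' < B -> acc <= X ^ (db + de) ->
      eval inp [:: i', acc & env] e <= X ^ de by move=> lt_B /(e_le _ _ lt_B) [].
    apply: leq_trans (acc_le_pow f_le B_le i_le) _.
    by rewrite expnD leq_mul // (leq_trans i_le).
  set m2 := set_nth 0 m1 (k + 1) 0; set m3 := set_nth 0 m2 (k + 2) 0.
  have safe1 := runs_safe run1.
  have safe2 : safe m2 by apply: safe_set.
  have safe3 : safe m3 by apply: safe_set.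
  (* Loop invariant: cell k + 2 holds the partial sum, and nothing below k has changed. *)
  pose J i m' o' := [/\ agree k m1 m', nth 0 m' (k + 2) = iteri i F 0 & o' = o].
  have J_ext i m4 m5 o1 : (forall a, a < k + 3 -> a != k + 1 -> nth 0 m5 a = nth 0 m4 a) ->
      J i m4 o1 -> J i m5 o1.
    move=> eq45 [agr4 tot4 ->]; split=> //; last by rewrite eq45 //; lia.
    by move=> a a_lt; rewrite eq45 ?agr4 //; lia.
  have loopP := @loop_runs P inp (X ^ K) k (p + mb + 2) body B J
      (X ^ time_deg r' e + 1) m3 o (pow_gt0 K) code_loop J_ext.
  have [|||||m' [o' [run' m'_3 [agr' tot' oE]]]] := loopP.
  + move=> i m4 o4 i_lt safe4 m4_k m4_i [agr4 tot4 ->].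
    have [_ /code_at_cat[/code_at_cat[code_e code_add] _]] := code_at_cat code_loop.
    rewrite /= -[_ + 2 + 2]addnA in code_e code_add *.
    have [at_add _] := code_at_cons code_add.
    have mod4 : models [:: k + 1, k + 2 & g] [:: i, iteri i F 0 & env] (k + 3) m4.
      rewrite -[X in X :: _ :: env]m4_i -tot4; do 2!(apply: models_cons; first by lia).
      apply: (models_agree _ agr4 (models_agree (leqnn k) agr1 mod_m)); exact: leq_addr.
    have [bnd' F_le] := e_le i _ i_lt (total_le i (ltnW i_lt)).
    have [m5 [run5 agr5 val5]] := IHe _ _ _ _ _ m4 o ok_e bnd' code_e mod4 safe4.
    have safe5 := runs_safe run5.
    exists (set_nth 0 m5 (k + 2) (iteri i.+1 F 0)), o; split.
    * apply: (runs_trans run5); apply: (runs_arith safe5 at_add).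
      rewrite /= (agr5 (k + 2)); last by lia.
      rewrite tot4 val5 size_cat /=; apply: refl_pc; last by lia.
      exact: (safe_pow _ _ _ _ safe5 (total_le _ i_lt) le_K).
    * by rewrite nth_set ltn_eqF ?agr5 //; lia.
    * by rewrite nth_set ltn_eqF ?agr5 //; lia.
    * split=> //; last by rewrite nth_set eqxx.
      move=> c c_lt; rewrite nth_set ltn_eqF; last by lia.
      by rewrite agr5 ?agr4 //; lia.
  + exact: safe3.
  + by rewrite !nth_set !ltn_eqF //; lia.
  + by rewrite nth_set ltn_eqF ?nth_set ?eqxx //; lia.
  + split=> //; last by rewrite nth_set eqxx.
    by move=> c c_lt; rewrite !nth_set !ltn_eqF //; lia.
  exists (set_nth 0 m' k (iteri B F 0)); rewrite nth_set eqxx; split=> //; last first.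
    exact: agree_trans (leqnn k) agr1 (agree_trans (leqnn k) agr' (agree_set _ _ (leqnn k))).
  (* The inner X ^ 3 >= 8 absorbs the six extra instructions per round, the outer one the code
     around the loop. *)
  apply: (@runs_le _ _ _ (X ^ time_deg r b + (2 + (B * (X ^ time_deg r' e + 1 + 5) + 2 + 1)))).
    rewrite expnD; set M := maxn _ _.
    have le_b : X ^ time_deg r b <= X ^ M by rewrite le_pow ?leq_maxl.
    have le_loop : X ^ db * X ^ time_deg r' e * X ^ 3 <= X ^ M.
      by rewrite -!expnD le_pow ?leq_maxr.
    have X3_ge : 8 <= X ^ 3 by rewrite (@leq_exp2r 2 X 3).
    have B_le' : B * (X ^ time_deg r' e + 6) <= X ^ db * X ^ time_deg r' e * X ^ 3.
      rewrite -mulnA leq_mul //; have := pow_gt0 (time_deg r' e); nia.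
    have := pow_gt0 M; nia.
  apply: (runs_trans run1).
  apply: (runs_const safe1 at0); apply: (runs_const safe2 at1).
  rewrite -[(p + mb).+2]addn2; apply: (runs_trans run'); rewrite oE.
  have safe' := runs_safe run'.
  have at2' : nth Halt P (p + mb + 2 + size body + 5) = Arith Add k (k + 2) (k + 3).
    by rewrite -at2 /loop !size_cat /=; congr nth; lia.
  (* The loop ends with 0 in its scratch cell k + 3, so adding that cell to the total merely copies
     the total. *)
  apply: (runs_arith safe' at2'); rewrite /= tot' m'_3 addn0 size_cat /= !size_cat /=.
  apply: refl_pc; last by rewrite -/mb; lia.
  exact: (safe_pow _ _ _ _ safe' (total_le _ (leqnn B)) le_K).
Qed.

End Compiler.

(* In [bit], index 0 is the output position and index 1 the value of [result]. *)
Definition output_program (result bound bit : expr) : program :=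
  let c1 := compile [::] 0 0 result in
  let c2 := compile [:: 0] 1 (size c1) bound in
  let p := size c1 + size c2 + 1 in
  c1 ++ c2 ++ [:: Const 2 0]
  ++ loop 1 p (compile [:: 2; 0] 4 (p + 2) bit ++ [:: Write 4]) ++ [:: Halt].

Definition output_ok (K : nat) (result bound bit : expr) : bool :=
  let dr := deg [::] result in
  [&& deg_ok K [::] result, deg_ok K [:: dr] bound & deg_ok K [:: deg [:: dr] bound; dr] bit].

Definition output_time (result bound bit : expr) : nat :=
  let dr := deg [::] result in
  let db := deg [:: dr] bound in
  maxn (maxn (time_deg [::] result) (time_deg [:: dr] bound))
    (db + time_deg [:: db; dr] bit + 3) + 3.

(** Cell 0 holds the result, cell 1 the loop bound and cell 2 the counter. The bit is computed in
    cell 4, the scratch cell of the loop, whose content is dead during the body. *)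
Lemma output_program_runs inp X K result bound bit :
  2 <= X -> (forall i, nth 0 inp i <= X) -> output_ok K result bound bit ->
  let P := output_program result bound bit in
  let b := eval inp [::] result in
  exists p m,
    runs P inp (X ^ K) (X ^ output_time result bound bit) init_config
      (Config p m [seq eval inp [:: i; b] bit != 0 | i <- iota 0 (eval inp [:: b] bound)])
    /\ nth Halt P p = Halt.
Proof.
move=> X_ge2 inp_le /and3P[ok_r ok_n ok_bit] P b.
set dr := deg [::] result in ok_n ok_bit; set dn := deg [:: dr] bound in ok_bit.
set n := eval inp [:: b] bound.
have le_pow := leq_pow X_ge2.
have X_gt0 := pow_gt0 X_ge2.
have code : code_at P 0 P by move=> i _; rewrite add0n.
pose c1 := compile [::] 0 0 result.
pose c2 := compile [:: 0] 1 (size c1) bound.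
pose p := size c1 + size c2 + 1.
pose body := compile [:: 2; 0] 4 (p + 2) bit ++ [:: Write 4].
have PE : P = c1 ++ c2 ++ [:: Const 2 0] ++ loop 1 p body ++ [:: Halt] by [].
rewrite [X in code_at _ _ X]PE in code.
have [code1 /code_at_cat[code2 /code_at_cons[at0 /code_at_cat[code_loop code_halt]]]] :=
  code_at_cat code.
rewrite !add0n in code2 at0 code_loop.
rewrite -[(size c1 + size c2).+1]addn1 -/p in code_loop.
have bnd0 : bounded X [::] [::] by split=> // i; rewrite nth_nil.
have safe0 : safe (X ^ K) [::] by move=> i; rewrite nth_nil.
have mod0 : models [::] [::] 0 [::] by [].
have [m1 [run1 _ val1]] := compile_runs X_ge2 inp_le [::] ok_r bnd0 code1 mod0 safe0.
rewrite -/b add0n in val1 run1.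
have safe1 := runs_safe run1.
have bnd1 : bounded X [:: dr] [:: b].
  by apply: bounded_cons (bnd0); apply: (eval_le_pow X_ge2 inp_le ok_r).
have mod1 : models [:: 0] [:: b] 1 m1 by split=> // -[].
have [m2 [run2 agr2 val2]] := compile_runs X_ge2 inp_le [::] ok_n bnd1 code2 mod1 safe1.
have safe2 := runs_safe run2.
have n_le : n <= X ^ dn := eval_le_pow X_ge2 inp_le ok_n bnd1.
set m3 := set_nth 0 m2 2 0.
have safe3 : safe (X ^ K) m3 by apply: safe_set.
pose J i (m : seq nat) o := nth 0 m 0 = b
  /\ o = [seq eval inp [:: j; b] bit != 0 | j <- iota 0 i].
have J_ext i m m' o : (forall a, a < 1 + 3 -> a != 1 + 1 -> nth 0 m' a = nth 0 m a) ->
    J i m o -> J i m' o by move=> eqm [m_0 oE]; split=> //; rewrite eqm.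
set dbit := time_deg [:: dn; dr] bit.
have loopP := @loop_runs P inp (X ^ K) 1 p body n J (X ^ dbit + 1) m3 [::]
  (X_gt0 K) code_loop J_ext.
have [|||||m' [o' [run' _ [_ oE]]]] := loopP.
- move=> i m4 o4 i_lt safe4 m4_1 m4_2 [m4_0 oE].
  have [_ /code_at_cat[/code_at_cat[code_bit /code_at_cons[at_write _]] _]] :=
    code_at_cat code_loop.
  have bnd2 : bounded X [:: dn; dr] [:: i; b].
    by apply: bounded_cons; first exact: leq_trans (ltnW i_lt) n_le.
  have mod4 : models [:: 2; 0] [:: i; b] 4 m4 by split=> // -[|[|]].
  have [m5 [run5 agr5 val5]] := compile_runs X_ge2 inp_le o4 ok_bit bnd2 code_bit mod4 safe4.
  exists m5, (rcons o4 (eval inp [:: i; b] bit != 0)); split; last 1 first.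
  + split; first by rewrite agr5.
    by rewrite oE -addn1 iotaD map_cat cats1.
  + apply: (runs_trans run5); apply: (runs_write (runs_safe run5) at_write).
    have -> : p + 2 + size body = (p + 2 + size (compile [:: 2; 0] 4 (p + 2) bit)).+1.
      by rewrite size_cat addnA [LHS]addn1.
    rewrite val5.
    by apply: runs_refl; apply: (runs_safe run5).
  + by rewrite agr5.
  + by rewrite agr5.
- exact: safe3.
- by rewrite nth_set.
- by rewrite nth_set.
- by split=> //; rewrite nth_set agr2.
exists (p + size body + 5), m'; rewrite -oE; split.
  apply: (@runs_le _ _ _ (X ^ time_deg [::] result
      + (X ^ time_deg [:: dr] bound + (1 + (n * (X ^ dbit + 1 + 5) + 2))))).
    rewrite expnD -/dr -/dn -/dbit; set M := maxn _ _.
    have le1 : X ^ time_deg [::] result <= X ^ M by rewrite le_pow // /M -maxnA leq_maxl.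
    have le2 : X ^ time_deg [:: dr] bound <= X ^ M.
      by rewrite le_pow // /M maxnAC leq_maxr.
    have le_loop : X ^ dn * X ^ dbit * X ^ 3 <= X ^ M by rewrite -!expnD le_pow ?leq_maxr.
    have X3_ge : 8 <= X ^ 3 by rewrite (@leq_exp2r 2 X 3).
    have n_le' : n * (X ^ dbit + 6) <= X ^ dn * X ^ dbit * X ^ 3.
      rewrite -mulnA leq_mul //; have := X_gt0 dbit; nia.
    have := X_gt0 M; nia.
  apply: (runs_trans run1); apply: (runs_trans run2).
  apply: (runs_const safe2 at0); rewrite -[(size c1 + size c2).+1]addn1; exact: run'.
have [at_halt _] := code_at_cons code_halt.
by rewrite -[RHS]at_halt /loop !size_cat /=; congr nth; rewrite /p; lia.
Qed.

(** Excluding indirect stores makes every destination visible in the program text, so that the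
    number of cells is a constant of the program. *)
Definition dest_lt (D : nat) (i : instr) : bool :=
  match i with
  | Const d _ | Arith _ d _ _ | LoadInd d _ | Read d _ => d < D
  | StoreInd _ _ => false
  | _ => true
  end.

Lemma size_mem_run P inp D t :
  all (dest_lt D) P -> size (Defs.mem (run P inp t)) <= D.
Proof.
move=> /(all_nthP Halt) dest_P; elim: t => // t.
rewrite [run P inp t.+1](_ : _ = step P inp (run P inp t)) //; set c := run P inp t => IH.
have : dest_lt D (fetch P c).
  by rewrite /fetch; case: (ltnP (pc c) (size P)) => [/dest_P//|le_P]; rewrite nth_default.
rewrite /step; case: (fetch P c) => [d k|o d s1 s2|d s|d s|d s|s|l|s l|] //= d_lt;
  rewrite ?size_set_nth ?geq_max ?d_lt //.
by case: ifP.
Qed.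

Lemma space_le c D V : size (Defs.mem c) <= D -> safe V (Defs.mem c) ->
  Defs.space c <= D * (trunc_log 2 V).+1.
Proof.
move=> size_c safe_c; rewrite /Defs.space.
apply: (@leq_trans (\sum_(v <- Defs.mem c) (trunc_log 2 V).+1)).
  rewrite big_seq [leqRHS]big_seq; apply: leq_sum => v /(nthP 0)[a _ <-].
  by rewrite /bit_length ltnS leq_trunc_log.
by rewrite big_const_seq count_predT iter_addn_0 mulnC leq_mul.
Qed.

Lemma runs_computes P inp V T D p m o :
  runs P inp V T init_config (Config p m o) -> nth Halt P p = Halt ->
  all (dest_lt D) P -> computes_within P inp o T (D * (trunc_log 2 V).+1).
Proof.
move=> [t t_le [run_t safe_t]] at_p dest_P; exists t; rewrite /run run_t; split=> //.
  by rewrite /halted /fetch /= at_p.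
by move=> s s_le; apply: space_le (size_mem_run _ _ dest_P) (safe_t _ s_le).
Qed.

(** * Primes between M and M ^ 2 *)

Lemma central_bin_ge n : 2 ^ n <= 'C(n.*2, n).
Proof.
elim: n => [|n IH]; first by rewrite bin0.
have le_bin : 'C(n.*2, n) <= 'C(n.*2.+1, n) by apply: leq_bin2l.
rewrite doubleS binS expnS mul2n -addnn leq_add //; last exact: leq_trans le_bin.
by apply: leq_trans IH _; rewrite binS leq_addl.
Qed.

(** Legendre's formula over a longer range, whose extra terms vanish; the formulas for two
    factorials can then be compared term by term. *)
Lemma logn_fact_wide p m M :
  prime p -> m <= M -> logn p m`! = \sum_(1 <= k < M.+1) m %/ p ^ k.
Proof.
move=> p_pr m_le; rewrite logn_fact // [RHS](big_cat_nat (n := m.+1)) //=.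
rewrite [X in _ + X]big_nat [X in _ + X]big1 ?addn0 // => k /andP[k_gt _].
by apply: divn_small; apply: ltn_trans k_gt (ltn_expl _ (prime_gt1 p_pr)).
Qed.

(** By Legendre's formula the exponent of p is the sum over k of the differences 2n %/ p ^ k - 2 (n
    %/ p ^ k). Each is 0 or 1, and it is 0 once p ^ k > 2n. *)
Lemma central_bin_pfactor p n :
  prime p -> 0 < n -> p ^ logn p 'C(n.*2, n) <= n.*2.
Proof.
move=> p_pr n_gt0; have p_gt1 := prime_gt1 p_pr.
have n2_gt0 : 0 < n.*2 by rewrite double_gt0.
have n_le : n <= n.*2 by rewrite -addnn leq_addr.
have logE : logn p 'C(n.*2, n) + (logn p n`!).*2 = logn p n.*2`!.
  rewrite -(bin_fact n_le) [n.*2 - n](_ : _ = n); last by rewrite -addnn addnK.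
  by rewrite !lognM ?muln_gt0 ?fact_gt0 ?bin_gt0 // addnn.
have sum_le t m : \sum_(1 <= k < m.+1) (k <= t) <= t.
  suff : \sum_(1 <= k < m.+1) (k <= t) <= minn m t by rewrite leq_min => /andP[].
  by elim: m => [|m IH]; [rewrite big_geq | rewrite big_nat_recr //=; lia].
suff le_log : logn p 'C(n.*2, n) <= trunc_log p n.*2.
  by apply: leq_trans (trunc_logP p_gt1 n2_gt0); rewrite leq_exp2l.
apply: leq_trans (sum_le _ n.*2).
rewrite -(leq_add2r (logn p n`!).*2) logE !(@logn_fact_wide p _ n.*2) //.
rewrite -[X in _ <= _ + X]addnn.
rewrite -!big_split /=; apply: leq_sum => k _.
have pk_gt0 : 0 < p ^ k by rewrite expn_gt0 ltnW.
case: (leqP k) => [_|k_gt]; last first.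
  rewrite divn_small //; have /leq_trans -> // := trunc_log_ltn n.*2 p_gt1.
  by rewrite leq_exp2l.
rewrite -ltnS ltn_divLR //.
have := divn_eq n (p ^ k); have := ltn_pmod n pk_gt0.
set a := n %/ _; set b := n %% _; set P := p ^ k; nia.
Qed.

Lemma pow4_lt_exp2 m : 16 < m -> m ^ 4 < 2 ^ m.
Proof.
elim: m => // m IH; rewrite leq_eqVlt => /predU1P[[<-]|m_gt]; first by lia.
rewrite [2 ^ _]expnS; have {}IH := IH m_gt.
have le4 : m.+1 ^ 4 <= 2 * m ^ 4.
  by rewrite !(expnS, expn0) ?muln1; nia.
lia.
Qed.

Lemma prime_dvd_fact q n : prime q -> q %| n`! -> q <= n.
Proof.
move=> q_pr; elim: n => [|n IH]; first by rewrite dvdn1 => /eqP q1; rewrite q1 in q_pr.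
by rewrite factS Euclid_dvdM // => /orP[/dvdn_leq->//|/IH/leqW].
Qed.

(* Were all primes up to M ^ 2 at most M, the central binomial coefficient of
   M ^ 2 would be a product of at most M prime powers, each at most M ^ 2. *)
Lemma prime_in_square m : 8 < m -> exists2 q, prime q & m.*2 < q <= m.*2 ^ 2.
Proof.
move=> m_gt; set M := m.*2; pose L := m * M.
have LE : L.*2 = M ^ 2 by rewrite /L /M expnS expn1 -!mul2n; lia.
have L_gt0 : 0 < L by rewrite /L /M; nia.
set B := 'C(L.*2, L); have B_gt0 : 0 < B by rewrite bin_gt0 -addnn leq_addr.
case: (boolP (has (fun q => M < q) (primes B))) => [/hasP[q]|/hasPn small].
  rewrite mem_primes => /and3P[q_pr _ q_dvd] q_gt; exists q => //.
  rewrite q_gt -LE; apply: prime_dvd_fact => //; apply: dvdn_trans q_dvd _.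
  by rewrite -(@bin_fact L.*2 L) ?dvdn_mulr // -addnn leq_addr.
have le1 : B <= L.*2 ^ size (primes B).
  rewrite {1}(prod_prime_decomp B_gt0) prime_decompE big_map /= big_seq.
  apply: (@leq_trans (\prod_(p <- primes B | p \in primes B) L.*2)).
    apply: leq_prod => p; rewrite mem_primes => /and3P[p_pr _ _].
    exact: central_bin_pfactor.
  by rewrite -big_seq big_const_seq iter_muln_1 count_predT.
have le2 : size (primes B) <= M.
  rewrite -(size_iota 1 M); apply: uniq_leq_size (primes_uniq _) _ => q q_B.
  move/(_ q q_B): small; rewrite -leqNgt mem_iota add1n ltnS => ->.
  by move: q_B; rewrite mem_primes andbT => /andP[/prime_gt0].
have /leq_trans/(_ (leq_pexp2l _ le2)) := leq_trans (central_bin_ge L) le1.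
rewrite double_gt0 LE -expnM /L => /(_ L_gt0).
(* The bounds on B give 2 ^ (m M) <= M ^ (2 M) = (M ^ 4) ^ m. This contradicts M ^ 4 < 2 ^ M, which
   holds since M >= 18. *)
have : (M ^ 4) ^ m < (2 ^ M) ^ m.
  by rewrite ltn_exp2r; [apply: pow4_lt_exp2; rewrite /M -muln2 | ]; lia.
rewrite -!expnM [M * m]mulnC (_ : 4 * m = 2 * M) => [lt_exp|]; first by rewrite leqNgt lt_exp.
by rewrite /M -muln2; lia.
Qed.

(** * Values of random polynomials at distinct points *)

Import Order.TTheory GRing.Theory Num.Theory.

Section Interpolation.

Variables (F : finFieldType) (K : nat).
Implicit Types (c : {ffun 'I_K -> F}) (s : seq F) (A : F -> {set F}).

Definition polyval c (x : F) : F := (\sum_(j < K) c j * x ^+ j)%R.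

Lemma polyval_inj s c d :
  uniq s -> size s = K -> {in s, polyval c =1 polyval d} -> c = d.
Proof.
move=> uniq_s size_s eq_cd; apply/ffunP => j; apply/eqP; rewrite -subr_eq0.
(* The difference has size at most K and K roots. [insubd j] turns an index below K back into an
   ordinal, with j as default value. *)
pose p : {poly F} := (\poly_(i < K) (c (insubd j i) - d (insubd j i)))%R.
have valE (i : 'I_K) : insubd j i = i by apply: val_inj; rewrite val_insubd ltn_ord.
have p0 : p = 0%R.
  apply: (roots_geq_poly_eq0 (rs := s)); rewrite ?size_s ?size_poly //.
  apply/allP => x x_s; rewrite rootE horner_poly.
  under eq_bigr => i _ do rewrite valE mulrBl.
  by rewrite sumrB -/(polyval c x) -/(polyval d x) eq_cd // subrr.
by have := coef_poly K (fun i => c (insubd j i) - d (insubd j i))%R j;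
  rewrite -/p p0 coef0 ltn_ord valE => <-.
Qed.

(** Evaluation at K distinct points is an injection between finite sets of equal size, hence a
    bijection, and the condition becomes a product set. *)
Lemma card_polyval_full s A : uniq s -> size s = K ->
  #|[set c | all (fun x => polyval c x \in A x) s]| = \prod_(x <- s) #|A x|.
Proof.
move=> uniq_s size_s.
pose f c : {ffun 'I_K -> F} := [ffun j : 'I_K => polyval c (nth 0%R s j)].
have inj_f : injective f.
  move=> c d /ffunP eq_f; apply: (polyval_inj uniq_s size_s) => x x_s.
  have idx : index x s < K by rewrite -size_s index_mem.
  by have := eq_f (Ordinal idx); rewrite !ffunE /= nth_index.
rewrite (big_nth 0%R) size_s big_mkord.
transitivity #|[set g in family (fun j : 'I_K => A (nth 0%R s j))]|; last first.
  by rewrite cardsE card_family foldrE big_map big_enum.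
rewrite -(card_imset _ inj_f); apply: eq_card => g.
have [f' fK f'K] := injF_bij inj_f.
rewrite -[g]f'K mem_imset // !inE; apply/allP/familyP => [all_s j|fam x x_s].
  by rewrite ffunE all_s // mem_nth // size_s.
have idx : index x s < K by rewrite -size_s index_mem.
by have := fam (Ordinal idx); rewrite ffunE /= nth_index.
Qed.

(** Fresh points at which every value is allowed are added until there are K of them; each
    contributes a factor #|F|. *)
Lemma card_polyval s A : uniq s -> size s <= K <= #|F| ->
  #|[set c | all (fun x => polyval c x \in A x) s]|
    = #|F| ^ (K - size s) * \prod_(x <- s) #|A x|.
Proof.
move=> uniq_s /andP[le_sK le_KF]; move: {2}(K - size s) (erefl (K - size s)) => d.
elim: d => [|d IH] in s A uniq_s le_sK * => dE.
  have size_s : size s = K by lia.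
  by rewrite card_polyval_full // size_s subnn mul1n.
have /existsP[x /= x_s] : [exists x, x \notin s].
  rewrite -negb_forall; apply/negP => /forallP all_s.
  have : #|F| <= size s by rewrite -(card_uniqP uniq_s) subset_leq_card //; apply/subsetP => x _.
  lia.
pose A' y := if y == x then [set: F] else A y.
have eqA : {in s, A' =1 A} by move=> y y_s; rewrite /A' ifN //; apply: contraNneq x_s => <-.
have card_A'x : #|A' x| = #|F| by rewrite /A' eqxx cardsT.
have {IH} := IH (x :: s) A'; rewrite /= x_s uniq_s big_cons card_A'x => IH.
transitivity (#|F| ^ (K - (size s).+1) * (#|F| * \prod_(y <- s) #|A' y|)).
  rewrite -IH //; [|lia|lia]; apply: eq_card => c; rewrite !inE /A' eqxx inE /=.
  by apply: eq_in_all => y /eqA; rewrite /A' => ->.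
rewrite mulnA -expnSr; congr (_ ^ _ * _); first by lia.
by rewrite !big_seq; apply: eq_bigr => y /eqA ->.
Qed.

(** Here the allowed set depends on a label, in the application a literal; labels with distinct
    points can be recovered from the points. *)
Lemma card_polyval_seq (T : eqType) (pt : T -> F) (A : T -> {set F}) (s : seq T) :
  uniq (map pt s) -> size s <= K <= #|F| ->
  #|[set c | all (fun l => polyval c (pt l) \in A l) s]|
    = #|F| ^ (K - size s) * \prod_(l <- s) #|A l|.
Proof.
move=> uniq_s size_s.
case: s => [|l0 s'] in uniq_s size_s *.
  by have := card_polyval (fun=> setT) uniq_s size_s; rewrite !big_nil.
set s := l0 :: s' in uniq_s size_s *.
pose B x := A (nth l0 s (index x (map pt s))).
have BE : {in s, forall l, B (pt l) = A l}.
  move=> l l_s; have idx : index l s < size s by rewrite index_mem.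
  rewrite /B -[in pt l](nth_index l0 l_s) -(nth_map l0 (pt l0)) //.
  by rewrite index_uniq ?size_map // nth_index.
have := card_polyval B uniq_s; rewrite size_map big_map !big_seq => cardB.
transitivity (#|F| ^ (K - size s) * \prod_(l <- s | l \in s) #|B (pt l)|).
  rewrite -cardB //; apply: eq_card => c; rewrite !inE all_map.
  by apply: eq_in_all => l /BE /= ->.
by congr (_ * _); apply: eq_bigr => l /BE ->.
Qed.

End Interpolation.

Lemma polyval_linear (F : finFieldType) (c : {ffun 'I_2 -> F}) x :
  polyval c x = (c ord0 + c ord_max * x)%R.
Proof.
rewrite /polyval big_ord_recr /= big_ord1 expr0 mulr1 expr1.
by congr (c _ + c _ * _)%R; apply: val_inj.
Qed.

Lemma polyval_cubic (F : finFieldType) (c : {ffun 'I_4 -> F}) x :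
  polyval c x =
    (((c (inord 3) * x + c (inord 2)) * x + c (inord 1)) * x + c (inord 0))%R.
Proof.
rewrite /polyval; under eq_bigr => j _ do rewrite -[j in c j]inord_val.
rewrite -(big_mkord predT (fun j => c (inord j) * x ^+ j)%R) !big_nat_recr //= big_geq //.
by ring.
Qed.

(** From all lines with values in [A] on s, the constant ones are removed; as s is nonempty, these
    are the #|A| constants in [A]. *)
Lemma card_nonconstant_line (F : finFieldType) (A : {set F}) (s : seq F) :
  uniq s -> 0 < size s <= 2 ->
  #|[set c : {ffun 'I_2 -> F} | (c ord_max != 0%R) && all (fun x => polyval c x \in A) s]|
    = #|F| ^ (2 - size s) * #|A| ^ size s - #|A|.
Proof.
move=> uniq_s /andP[s_gt0 s_le2].
have F_gt1 : 1 < #|F| by rewrite (cardD1 0%R) (cardD1 1%R) !inE oner_eq0.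
have := @card_polyval F 2 s (fun=> A) uniq_s; rewrite s_le2 => /(_ F_gt1).
rewrite big_const_seq count_predT iter_muln_1 => <-.
set U := [set c | all _ s]; set L := [set c | _ && _].
rewrite -(cardsID [set c : {ffun 'I_2 -> F} | c ord_max != 0%R] U).
have -> : U :&: [set c : {ffun 'I_2 -> F} | c ord_max != 0%R] = L.
  by apply/setP => c; rewrite !inE andbC.
pose const a : {ffun 'I_2 -> F} := [ffun i => if i == ord0 then a else 0%R].
have const_inj : injective const.
  by move=> a b /ffunP/(_ ord0); rewrite !ffunE.
suff -> : U :\: [set c : {ffun 'I_2 -> F} | c ord_max != 0%R] = [set const a | a in A].
  by rewrite card_imset // addnK.
apply/setP => c; rewrite !inE negbK; apply/andP/imsetP => [[/eqP c1 all_s]|[a aA ->]].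
  exists (c ord0).
    case: s s_gt0 all_s {uniq_s s_le2 U L} => //= x s _ /andP[].
    by rewrite polyval_linear c1 mul0r addr0.
  apply/ffunP => i; rewrite ffunE; case: eqP => [->//|/eqP].
  by case: i => [[|[|]]] //= i_lt _; rewrite -c1; congr (c _); apply: val_inj.
rewrite ffunE /= eqxx; split=> //; apply/allP => x _.
by rewrite polyval_linear !ffunE /= mul0r addr0.
Qed.

(** * Majorities and averaging *)

Section Majority.

Variables (n : nat) (F : cnf n).

(* The weights are 4 d_j for the coefficients d_1 = 1, d_2 = 1/2, d_3 = 1/4
   and d_j = 0 otherwise. *)
Definition clause_weight (C : clause n) : nat := nth 0 [:: 0; 4; 2; 1] (size (undup C)).

Definition bias (l : literal n) : nat := \sum_(C <- F) clause_weight C * (l \in C).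

Definition majority : assignment n := [ffun i => bias (i, false) <= bias (i, true)].

(** Double counting. The right-hand side separates over the variables, so it can be maximized one
    variable at a time. *)
Lemma weighted_count_bias (y : assignment n) :
  \sum_(C <- F) clause_weight C * count (lit_true y) (undup C) = \sum_i bias (i, y i).
Proof.
have countE (C : clause n) : count (lit_true y) (undup C) = \sum_i ((i, y i) \in C).
  rewrite -sum1_count (eq_bigl (fun l => l == (l.1, y l.1))); last first.
    by case=> i b; rewrite /lit_true xpair_eqE eqxx eq_sym.
  rewrite big_mkcond big_uniq ?undup_uniq //= -big_mkcondr /=.
  rewrite (reindex_onto (fun i => (i, y i)) fst) /=; last first.
    by case=> i b /andP[_ /eqP].
  rewrite big_mkcond; apply: eq_bigr => i _.
  by rewrite mem_undup !eqxx !andbT; case: (_ \in _).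
under eq_bigr do rewrite countE big_distrr /=.
by rewrite exchange_big.
Qed.

Lemma majority_max (y : assignment n) :
  \sum_(C <- F) clause_weight C * count (lit_true y) (undup C)
    <= \sum_(C <- F) clause_weight C * count (lit_true majority) (undup C).
Proof.
rewrite !weighted_count_bias; apply: leq_sum => i _; rewrite ffunE.
by case: (y i); case: (leqP (bias (i, false)) (bias (i, true))) => [|/ltnW].
Qed.

Lemma clause_sat_undup (y : assignment n) (C : clause n) :
  clause_sat y C = has (lit_true y) (undup C).
Proof. by apply: eq_has_r => l; rewrite mem_undup. Qed.

End Majority.

Section Averaging.

Variables (R : rcfType) (n : nat) (F : cnf n).

Local Open Scope ring_scope.

Definition sqrt2 : R := Num.sqrt 2.

Lemma sqrt2_sqr : sqrt2 * sqrt2 = 2.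
Proof. by rewrite -expr2 sqr_sqrtr ?ler0n. Qed.

(** 99/70 is a continued fraction convergent of sqrt 2 from above, and 140/99 = 2 / (99/70). *)
Lemma sqrt2_gt : 140 / 99 < sqrt2.
Proof.
have s2 := sqrt2_sqr; have s_ge : 0 <= sqrt2 by rewrite sqrtr_ge0. nra.
Qed.

Lemma sqrt2_lt : sqrt2 < 99 / 70.
Proof.
have s2 := sqrt2_sqr; have s_ge : 0 <= sqrt2 by rewrite sqrtr_ge0. nra.
Qed.

(** The slope sqrt 2 - 1 makes this exactly the satisfaction probability under independence for unit
    clauses and for two distinct variables with literals of the same sign. It is meant for nonempty
    clauses: at the empty clause it still equals sqrt 2 / 2. *)
Definition sat_goal (C : clause n) : R :=
  sqrt2 / 2 + (sqrt2 - 1) * ((clause_weight C)%:R / 4)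
    * ((count (lit_true (majority F)) (undup C))%:R - 1).

(* A clause is satisfied only if at least one of its literals is true, and the
   weighted number of true literals is largest for the majority assignment. *)
Lemma opt_le_sat_goal (y : assignment n) :
  sqrt2 / 2 * (nsat y F)%:R <= \sum_(C <- F | C != [::]) sat_goal C.
Proof.
have s_gt := sqrt2_gt; have s_lt := sqrt2_lt.
pose g (C : clause n) : R := sqrt2 / 2 + (sqrt2 - 1) / 4
  * ((clause_weight C * count (lit_true y) (undup C))%:R - (clause_weight C)%:R).
apply: (@le_trans _ _ (\sum_(C <- F | C != [::]) g C)).
  rewrite /nsat -sum1_count natr_sum mulr_sumr [leLHS]big_mkcond [leRHS]big_mkcond /=.
  apply: ler_sum => C _.
  have w_le : (clause_weight C <= 4)%N.
    by rewrite /clause_weight; case: size => [|[|[|[|j]]]] //=; rewrite nth_nil.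
  have wR : (clause_weight C)%:R <= 4 :> R by rewrite ler_nat.
  have wR0 : 0 <= (clause_weight C)%:R :> R by rewrite ler0n.
  have [->|_] := eqVneq C [::]; first by [].
  case: ifP => [|_].
    rewrite clause_sat_undup has_count => cnt_gt0.
    rewrite mulr1 lerDl mulr_ge0 //; first by lra.
    by rewrite subr_ge0 ler_nat leq_pmulr.
  (* For a falsified clause g must be nonnegative; it is at least sqrt 2 / 2 - (sqrt 2 - 1), as w /
     4 <= 1. *)
  have : 0 <= (clause_weight C * count (lit_true y) (undup C))%:R :> R by rewrite ler0n.
  rewrite /= /g; set c := (_ * _)%:R; set w := (clause_weight C)%:R => c_ge0.
  have : 0 <= (sqrt2 - 1) * (c + (4 - w)) by rewrite mulr_ge0 //; lra.
  by lra.
have goalE C : sat_goal C = sqrt2 / 2 + (sqrt2 - 1) / 4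
    * ((clause_weight C * count (lit_true (majority F)) (undup C))%:R
       - (clause_weight C)%:R).
  by rewrite /sat_goal natrM; field.
under [leRHS]eq_bigr do rewrite goalE.
rewrite !big_split /= lerD2l -!mulr_sumr ler_wpM2l //; first by lra.
rewrite !sumrB lerD2r -!natr_sum ler_nat.
(* Empty clauses have weight 0, so leaving them out does not change the weighted sums. *)
have nonempty_sum (y' : assignment n) :
    (\sum_(C <- F | C != [::]) clause_weight C * count (lit_true y') (undup C)
     = \sum_(C <- F) clause_weight C * count (lit_true y') (undup C))%N.
  by rewrite big_mkcond; apply: eq_bigr => C _; case: eqP => // ->.
by rewrite !nonempty_sum majority_max.
Qed.

(** A bound on every assignment of the family bounds the mean number of satisfied clauses, which is
    at least the sum of the goals. *)
Lemma averaging (I : finType) (mu : I -> R) (X : I -> assignment n) (B : nat) :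
  (forall i, 0 <= mu i) -> \sum_i mu i = 1 ->
  (forall C, C \in F -> C != [::] ->
     sat_goal C <= \sum_i mu i * (clause_sat (X i) C)%:R) ->
  (forall i, nsat (X i) F <= B)%N ->
  sqrt2 / 2 * (max_sat F)%:R <= B%:R.
Proof.
move=> mu_ge0 mu1 goal_le le_B.
have [|y max_y] := @bigop.eq_bigmax _ (fun x : {ffun 'I_n -> bool} => nsat x F).
  by rewrite card_ffun card_bool expn_gt0.
rewrite /max_sat max_y.
apply: le_trans (opt_le_sat_goal y) _.
apply: (@le_trans _ _ (\sum_(C <- F) \sum_i mu i * (clause_sat (X i) C)%:R)).
  rewrite big_mkcond big_seq [leRHS]big_seq; apply: ler_sum => C C_F.
  case: ifP => [|_]; first exact: goal_le.
  by apply: sumr_ge0 => i _; rewrite mulr_ge0 // ler0n.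
have -> : B%:R = \sum_i mu i * B%:R :> R by rewrite -mulr_suml mu1 mul1r.
rewrite exchange_big /=; apply: ler_sum => i _.
rewrite -mulr_sumr ler_wpM2l // -natr_sum ler_nat.
by apply: leq_trans (le_B i); rewrite /nsat -sum1_count [leqRHS]big_mkcond.
Qed.

End Averaging.

(** * Threshold assignments *)

Definition threshold_assignment n (F : cnf n) (t : nat) (h : 'I_n -> nat) : assignment n :=
  [ffun i => (h i < t) == majority F i].

Definition cubic_hash (q c0 c1 c2 c3 i : nat) : nat :=
  (((c3 * i + c2) * i + c1) * i + c0) %% q.

Definition hash_assignment n (F : cnf n) (q t c0 c1 c2 c3 : nat) : assignment n :=
  threshold_assignment F t (fun i => cubic_hash q c0 c1 c2 c3 i).

Section HashFamilies.

Variables (n : nat) (F : cnf n) (q : nat).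
Hypotheses (q_prime : prime q) (lt_nq : n < q).

Definition point (i : 'I_n) : 'F_q := ((i : nat)%:R)%R.

Lemma point_inj : injective point.
Proof.
move=> i j /(congr1 val); rewrite /= /point !val_Fp_nat // !modn_small ?(ltn_trans _ lt_nq) //.
exact: val_inj.
Qed.

Definition poly_assignment K (t : nat) (c : {ffun 'I_K -> 'F_q}) : assignment n :=
  threshold_assignment F t (fun i => polyval c (point i)).

Lemma poly_assignment_cubic t (c : {ffun 'I_4 -> 'F_q}) :
  poly_assignment t c = hash_assignment F q t (c (inord 0)) (c (inord 1))
                          (c (inord 2)) (c (inord 3)).
Proof.
apply/ffunP => i; rewrite !ffunE; congr ((_ < _) == _).
by rewrite /cubic_hash -val_Fp_nat // !(natrD, natrM) !natr_Zp polyval_cubic.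
Qed.

(** Lines are cubics with two zero coefficients, so one seed space covers both families. *)
Lemma poly_assignment_linear t (c : {ffun 'I_2 -> 'F_q}) :
  poly_assignment t c = hash_assignment F q t (c ord0) (c ord_max) 0 0.
Proof.
apply/ffunP => i; rewrite !ffunE; congr ((_ < _) == _).
rewrite /cubic_hash !(mul0n, add0n) -val_Fp_nat // natrD natrM !natr_Zp.
by rewrite polyval_linear addrC.
Qed.

Definition falsifying (t : nat) (l : literal n) : {set 'F_q} :=
  [set v : 'F_q | (v < t) != lit_true (majority F) l].

Lemma lit_false_poly K t (c : {ffun 'I_K -> 'F_q}) l :
  ~~ lit_true (poly_assignment t c) l = (polyval c (point l.1) \in falsifying t l).
Proof.
rewrite inE /lit_true [poly_assignment t c _]ffunE.
by case: (_ < t) (majority F l.1) (l.2) => [] [] [].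
Qed.

Definition falsifying_count t (l : literal n) : nat :=
  if lit_true (majority F) l then q - t else t.

Lemma card_falsifying t l : t <= q -> #|falsifying t l| = falsifying_count t l.
Proof.
move=> t_le; have card_lt : #|[set v : 'F_q | v < t]| = t.
  rewrite cardsE -sum1_card.
  have t_le' : t <= (Zp_trunc (pdiv q)).+2 by rewrite Fp_cast.
  by rewrite -(big_ord_widen _ (fun=> 1) t_le') sum1_card card_ord.
rewrite /falsifying_count; case: ifP => [pos|neg]; last first.
  by rewrite -[RHS]card_lt; apply: eq_card => v; rewrite !inE neg eqbF_neg negbK.
rewrite cardsCs card_Fp //; congr (q - _); rewrite -[RHS]card_lt.
by apply: eq_card => v; rewrite !inE pos eqb_id negbK.
Qed.

Lemma card_all_false K t (s : seq (literal n)) :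
  uniq (map fst s) -> size s <= K <= q -> t <= q ->
  #|[set c : {ffun 'I_K -> 'F_q} | all (fun l => ~~ lit_true (poly_assignment t c) l) s]|
    = q ^ (K - size s) * \prod_(l <- s) falsifying_count t l.
Proof.
move=> uniq_s size_s t_le.
have := @card_polyval_seq 'F_q K _ (fun l : literal n => point l.1) (falsifying t) s.
rewrite map_comp (map_inj_uniq point_inj) card_Fp // => /(_ uniq_s size_s) cardE.
under eq_bigr do rewrite -card_falsifying //.
rewrite -cardE; apply: eq_card => c; rewrite !inE.
by apply: eq_all => l; rewrite lit_false_poly.
Qed.

Lemma card_line_all_false t (s : seq (literal n)) a :
  uniq (map fst s) -> 0 < size s <= 2 -> t <= q ->
  {in s, forall l, lit_true (majority F) l = a} ->
  let N := if a then q - t else t in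
  #|[set c : {ffun 'I_2 -> 'F_q} |
      (c ord_max != 0%R) && all (fun l => ~~ lit_true (poly_assignment t c) l) s]|
    = q ^ (2 - size s) * N ^ size s - N.
Proof.
move=> uniq_s size_s t_le pos_s N.
case: s => [//|l0 s'] in uniq_s size_s pos_s *; set s := l0 :: s' in uniq_s size_s pos_s *.
have l0_s : l0 \in s by apply: mem_head.
have := @card_nonconstant_line 'F_q (falsifying t l0) (map (fun l => point l.1) s).
rewrite map_comp (map_inj_uniq point_inj) !size_map card_Fp // card_falsifying //.
rewrite /falsifying_count pos_s // -/N => <- //.
apply: eq_card => c; rewrite !inE -map_comp all_map; congr (_ && _).
by apply: eq_in_all => l l_s; rewrite lit_false_poly /= !inE !pos_s.
Qed.

End HashFamilies.

(** * Falsification probabilities for the mixed family *)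

Section Mean.

Variables (R : rcfType) (n : nat) (F : cnf n) (q : nat).
Hypotheses (q_prime : prime q) (lt_nq : n < q) (q_gt : 256 < q).

Local Open Scope ring_scope.

Local Notation cubics := {ffun 'I_4 -> 'F_q}.
Local Notation lines := {ffun 'I_2 -> 'F_q}.
Local Notation Q := (q%:R : R).

Lemma Q_gt : 256 < Q. Proof. by rewrite (ltr_nat R 256). Qed.

(** The probability of [P] for a uniform cubic, taken with weight 49/50, or a uniform nonconstant
    line, with weight 1/50. *)
Definition mean_at (t : nat) (P : pred (assignment n)) : R :=
  49 / 50 * (#|[set c : cubics | P (poly_assignment F t c)]|%:R / Q ^+ 4)
  + 1 / 50 * (#|[set c : lines | (c ord_max != 0) && P (poly_assignment F t c)]|%:R
              / (Q * (Q - 1))).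

Lemma card_nonconstant_lines : #|[set c : lines | c ord_max != 0]|%:R = Q * (Q - 1) :> R.
Proof.
have := @card_nonconstant_line 'F_q setT [:: 0] isT isT.
rewrite cardsT card_Fp //= !expn1 => cardE.
have -> : #|[set c : lines | c ord_max != 0]| = (q * q - q)%N.
  by rewrite -cardE; apply: eq_card => c; rewrite !inE !andbT.
by rewrite natrB ?leq_pmulr ?prime_gt0 // natrM; ring.
Qed.

Lemma mean_at_const t (b : bool) : mean_at t (fun=> b) = b%:R.
Proof.
have q_gt' := Q_gt; rewrite /mean_at; case: b.
  have -> : #|[set c : cubics | true]| = (q ^ 4)%N.
    by rewrite cardsT card_ffun card_Fp // card_ord.
  under eq_finset do rewrite andbT.
  rewrite card_nonconstant_lines natrX [RHS](_ : _ = 1) //; field.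
  by apply/andP; split; apply: lt0r_neq0; lra.
have -> : [set c : cubics | false] = set0 by apply/setP => c; rewrite !inE.
under eq_finset do rewrite andbF.
have -> : [set c : lines | false] = set0 by apply/setP => c; rewrite !inE.
by rewrite !cards0 !mul0r !mulr0 addr0.
Qed.

Lemma le_mean_at t (P P' : pred (assignment n)) :
  subpred P P' -> mean_at t P <= mean_at t P'.
Proof.
move=> sub; have q_gt' := Q_gt.
apply: lerD; (rewrite ler_wpM2l ?ler_wpM2r ?ler_nat //; try lra).
- by rewrite invr_ge0 exprn_ge0 //; lra.
- by apply/subset_leq_card/subsetP => c; rewrite !inE; apply: sub.
- by rewrite invr_ge0 mulr_ge0; lra.
by apply/subset_leq_card/subsetP => c; rewrite !inE => /andP[->]; apply: sub.
Qed.

Lemma mean_atC t (P : pred (assignment n)) : mean_at t P = 1 - mean_at t (predC P).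
Proof.
apply/eqP; rewrite -subr_eq0 opprB addrA subr_eq0 -[eqbRHS](mean_at_const t true).
rewrite /mean_at addrACA -!mulrDr -!mulrDl -!natrD.
apply/eqP; congr (_ * (_%:R / _) + _ * (_%:R / _)).
  rewrite -cardsUI [X in (_ + #|pred_of_set X|)%N](_ : _ = set0).
    by rewrite cards0 addn0; apply: eq_card => c; rewrite !inE /= orbN.
  by apply/setP => c; rewrite !inE /= andbN.
rewrite -cardsUI [X in (_ + #|pred_of_set X|)%N](_ : _ = set0).
  by rewrite cards0 addn0; apply: eq_card => c; rewrite !inE /= -andb_orr orbN.
by apply/setP => c; rewrite !inE /= -andbA; case: (P _); rewrite ?andbF.
Qed.

Definition all_false (s : seq (literal n)) (y : assignment n) : bool :=
  all (fun l => ~~ lit_true y l) s.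

Definition false_freq (t : nat) (l : literal n) : R := (falsifying_count F q t l)%:R / Q.

(** Values of a random cubic at up to four distinct points are independent. *)
Lemma cubics_all_false t (s : seq (literal n)) :
  uniq (map fst s) -> (size s <= 4)%N -> (t <= q)%N ->
  #|[set c : cubics | all_false s (poly_assignment F t c)]|%:R / Q ^+ 4
    = \prod_(l <- s) false_freq t l.
Proof.
move=> uniq_s size_s t_le; have q_gt' := Q_gt.
have q_gt4 : (4 <= q)%N by apply: leq_trans q_gt.
rewrite card_all_false ?size_s // natrM natr_prod big_split /=.
rewrite prodfV big_const_seq count_predT iter_mulr_1 natrX.
rewrite -[in Q ^+ 4](subnK size_s) exprD invfM mulrACA divff ?mul1r //.
by rewrite expf_neq0 // lt0r_neq0; lra.
Qed.

(** The probability for lines is bounded by 1, at a cost of 1/50; only clauses with slack use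
    this. *)
Lemma mean_at_all_false_le t (s : seq (literal n)) :
  uniq (map fst s) -> (size s <= 4)%N -> (t <= q)%N ->
  mean_at t (all_false s) <= 1 / 50 + 49 / 50 * \prod_(l <- s) false_freq t l.
Proof.
move=> uniq_s size_s t_le; have q_gt' := Q_gt.
rewrite /mean_at cubics_all_false // addrC lerD2r -[leRHS]mulr1 ler_wpM2l //; first by lra.
rewrite ler_pdivrMr ?mul1r; last by rewrite mulr_gt0; lra.
rewrite -card_nonconstant_lines ler_nat; apply/subset_leq_card/subsetP => c.
by rewrite !inE => /andP[].
Qed.

(** A single value of a random nonconstant line is uniform too: (q N - N) / (q (q - 1)) = N / q. *)
Lemma mean_at_all_false1 t l : (t <= q)%N -> mean_at t (all_false [:: l]) = false_freq t l.
Proof.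
move=> t_le; have q_gt' := Q_gt; rewrite /mean_at cubics_all_false // big_seq1.
rewrite (@card_line_all_false _ F q _ _ t _ (lit_true (majority F) l)) //=; last first.
  by move=> l'; rewrite inE => /eqP ->.
rewrite -/(falsifying_count F q t l) !expn1 natrB ?leq_pmull ?prime_gt0 //.
rewrite /false_freq natrM; field.
by apply/andP; split; apply: lt0r_neq0; lra.
Qed.

(** The probability that two values fall in a set of m elements: cubics draw them with replacement,
    nonconstant lines without. *)
Definition pair_mean (m : R) : R :=
  49 / 50 * (m ^+ 2 / Q ^+ 2) + 1 / 50 * ((m ^+ 2 - m) / (Q * (Q - 1))).

Lemma mean_at_all_false2 t l1 l2 : (t <= q)%N -> l1.1 != l2.1 ->
  lit_true (majority F) l1 = lit_true (majority F) l2 ->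
  mean_at t (all_false [:: l1; l2]) = pair_mean (falsifying_count F q t l1)%:R.
Proof.
move=> t_le neq12 same; set N := _%:R; have q_gt' := Q_gt.
rewrite /mean_at cubics_all_false //; last by rewrite /= inE neq12.
rewrite !big_cons big_nil mulr1 /false_freq {2}/falsifying_count -same.
rewrite -/(falsifying_count F q t l1) -/N.
rewrite (@card_line_all_false _ F q _ _ t [:: l1; l2] (lit_true (majority F) l1)) //=; first last.
- by move=> l'; rewrite !inE => /pred2P[] ->.
- by rewrite inE neq12.
rewrite -/(falsifying_count F q t l1) subnn mul1n natrB ?natrX -/N; last first.
  by rewrite expnS expn1; case: (falsifying_count _ _ _ _) => // k; rewrite leq_pmull.
by rewrite /pair_mean; congr (_ * _ + _); rewrite mulf_div.
Qed.

End Mean.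

Lemma nat_floor_exists (R : realFieldType) (z : R) (m : nat) : (0 <= z < m%:R)%R ->
  exists2 t, t < m & (t%:R <= z < t.+1%:R)%R.
Proof.
elim: m => [|m IH] /andP[z_ge z_lt]; first by move: z_ge; rewrite leNgt z_lt.
have [le_mz|lt_zm] := lerP m%:R%R z; first by exists m; rewrite // le_mz.
by have [|t t_lt] := IH; [rewrite z_ge | exists t => //; apply: ltnW].
Qed.

(** * Rounding the threshold *)

Section Rounding.

Variables (R : rcfType) (n : nat) (F : cnf n) (q : nat).
Hypotheses (q_prime : prime q) (lt_nq : n < q) (q_gt : 256 < q).

Local Open Scope ring_scope.

Local Notation Q := (q%:R : R).
Local Notation s2 := (sqrt2 R).

Variable t : nat.
Hypotheses (lt_tq : (t < q)%N) (t_floor : t%:R <= s2 / 2 * Q < t.+1%:R).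

(** The probability of using t + 1 instead of t; the mean threshold is then exactly sqrt 2 / 2 *
    Q. *)
Let theta : R := s2 / 2 * Q - t%:R.

Let theta_bounds : 0 <= theta <= 1.
Proof. by move: t_floor; rewrite /theta -[t.+1%:R]natr1; lra. Qed.

Definition mean (P : pred (assignment n)) : R :=
  (1 - theta) * mean_at R F q t P + theta * mean_at R F q t.+1 P.

Lemma mean_le (P : pred (assignment n)) (M : R) :
  mean_at R F q t P <= M -> mean_at R F q t.+1 P <= M -> mean P <= M.
Proof.
move=> le0 le1; have /andP[th0 th1] := theta_bounds; rewrite /mean.
have : 0 <= (1 - theta) * (M - mean_at R F q t P) by rewrite mulr_ge0; lra.
have : 0 <= theta * (M - mean_at R F q t.+1 P) by rewrite mulr_ge0; lra.
lra.
Qed.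

Lemma le_mean (P P' : pred (assignment n)) : subpred P P' -> mean P <= mean P'.
Proof.
move=> sub; have /andP[th0 th1] := theta_bounds.
by rewrite /mean lerD // ler_wpM2l ?le_mean_at //; lra.
Qed.

(** Rational bounds for 1 - sqrt 2 / 2 (about 0.293) and sqrt 2 / 2 (about 0.707), with room for a
    rounding error of 1 / q < 1 / 256. *)
Definition freq_bound (l : literal n) : R :=
  if lit_true (majority F) l then 3 / 10 else 5 / 7.

Lemma false_freqE (u : nat) l : (u <= q)%N ->
  false_freq R F q u l = if lit_true (majority F) l then 1 - u%:R / Q else u%:R / Q.
Proof.
move=> u_le; rewrite /false_freq /falsifying_count; case: ifP => // _.
have q_gt' : 256 < Q := Q_gt R q_gt.
by rewrite natrB //; field; apply: lt0r_neq0; lra.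
Qed.

Lemma false_freq_le (u : nat) l : (t <= u <= t.+1)%N ->
  0 <= false_freq R F q u l <= freq_bound l.
Proof.
move=> /andP[t_le le_t]; have u_le : (u <= q)%N by apply: leq_trans le_t _.
have q_gt' : 256 < Q := Q_gt R q_gt.
have s_gt := sqrt2_gt R; have s_lt := sqrt2_lt R.
rewrite false_freqE // /freq_bound.
have tR : t%:R <= u%:R :> R by rewrite ler_nat.
have uR : u%:R <= t%:R + 1 :> R by rewrite natr1 ler_nat.
move: t_floor; rewrite -[t.+1%:R]natr1 => /andP[floor1 floor2].
have sQ_ge : 140 / 99 * Q <= s2 * Q by rewrite ler_wpM2r; lra.
have sQ_le : s2 * Q <= 99 / 70 * Q by rewrite ler_wpM2r; lra.
have lo : 7 / 10 <= u%:R / Q by rewrite ler_pdivlMr; lra.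
have hi : u%:R / Q <= 5 / 7 by rewrite ler_pdivrMr; lra.
by case: ifP => _; lra.
Qed.

Lemma mean_all_false_le (s : seq (literal n)) :
  uniq (map fst s) -> (size s <= 4)%N ->
  mean (all_false s) <= 1 / 50 + 49 / 50 * \prod_(l <- s) freq_bound l.
Proof.
move=> uniq_s size_s.
suff le_at u : (t <= u <= t.+1)%N ->
    mean_at R F q u (all_false s) <= 1 / 50 + 49 / 50 * \prod_(l <- s) freq_bound l.
  by apply: mean_le; apply: le_at; rewrite leqnn leqnSn.
move=> u_t; have u_le : (u <= q)%N by case/andP: u_t => _ /leq_trans; apply.
apply: le_trans (mean_at_all_false_le R F q_prime lt_nq q_gt uniq_s size_s u_le) _.
rewrite lerD2l ler_wpM2l //; first by lra.
by apply: ler_prod => l _; apply: false_freq_le.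
Qed.

(** The probability is affine in the threshold, so mixing t and t + 1 leaves no rounding error. *)
Lemma mean_all_false1 l :
  mean (all_false [:: l]) = if lit_true (majority F) l then 1 - s2 / 2 else s2 / 2.
Proof.
have q_gt' : 256 < Q := Q_gt R q_gt.
rewrite /mean !mean_at_all_false1 ?(ltnW lt_tq) // !false_freqE ?(ltnW lt_tq) //.
rewrite /theta -[t.+1%:R]natr1.
by case: ifP => _; field; apply: lt0r_neq0; lra.
Qed.

(* The variance of the rounded threshold costs at most [1 / 4 q ^ 2], which the
   negative correlation along nonconstant lines compensates. *)
Lemma pair_mean_le (m0 m1 th p : R) :
  0 <= th <= 1 -> (m0 - m1) ^+ 2 = 1 ->
  (1 - th) * m0 + th * m1 = p * Q -> 1 / 20 <= p * (1 - p) ->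
  (1 - th) * pair_mean q m0 + th * pair_mean q m1 <= p ^+ 2.
Proof.
move=> /andP[th0 th1] gap meanE p_le; have q_gt' : 256 < Q := Q_gt R q_gt.
(* The second moment of the rounded count, which exceeds the squared mean by the variance th (1 -
   th) <= 1/4. *)
pose S := (1 - th) * m0 ^+ 2 + th * m1 ^+ 2.
have S_le : S <= (p * Q) ^+ 2 + 1 / 4.
  rewrite -meanE /S; have := sqr_ge0 (th - 1 / 2).
  have -> : (1 - th) * m0 ^+ 2 + th * m1 ^+ 2 =
    ((1 - th) * m0 + th * m1) ^+ 2 + th * (1 - th) * (m0 - m1) ^+ 2 by ring.
  by rewrite gap; lra.
have -> : (1 - th) * pair_mean q m0 + th * pair_mean q m1 =
    49 / 50 * (S / Q ^+ 2) + 1 / 50 * ((S - p * Q) / (Q * (Q - 1))).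
  rewrite -meanE /pair_mean /S; field.
  by apply/andP; split; apply: lt0r_neq0; lra.
rewrite -subr_ge0.
(* Over a common denominator, the lines gain Q ^ 2 p (1 - p) >= Q ^ 2 / 20 while the variance costs
   (50 Q - 49) / 4, which is smaller for Q > 256. *)
have -> : p ^+ 2 - (49 / 50 * (S / Q ^+ 2) + 1 / 50 * ((S - p * Q) / (Q * (Q - 1)))) =
   (((p * Q) ^+ 2 + 1 / 4 - S) * (50 * Q - 49)
     + (Q * Q * (p * (1 - p)) - (50 * Q - 49) / 4)) / (50 * Q ^+ 2 * (Q - 1)).
  field; by apply/andP; split; apply: lt0r_neq0; lra.
apply: divr_ge0; last by rewrite !mulr_ge0 ?exprn_ge0; lra.
apply: addr_ge0; first by rewrite mulr_ge0; lra.
have : Q * Q * (1 / 20) <= Q * Q * (p * (1 - p)) by rewrite ler_wpM2l // mulr_ge0; lra.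
nra.
Qed.

Lemma mean_all_false2 l1 l2 : l1.1 != l2.1 ->
  lit_true (majority F) l1 = lit_true (majority F) l2 ->
  mean (all_false [:: l1; l2])
    <= (if lit_true (majority F) l1 then 1 - s2 / 2 else s2 / 2) ^+ 2.
Proof.
move=> neq12 same; have s_gt := sqrt2_gt R; have s_lt := sqrt2_lt R.
have s_sq := sqrt2_sqr R.
rewrite /mean !(mean_at_all_false2 _ q_prime) ?(ltnW lt_tq) // /falsifying_count.
case: ifP => _; apply: pair_mean_le => //; rewrite /theta.
- by rewrite !natrB ?(ltnW lt_tq) // -[t.+1%:R]natr1; ring.
- by rewrite !natrB ?(ltnW lt_tq) // -[t.+1%:R]natr1; ring.
- by lra.
- by rewrite -[t.+1%:R]natr1; ring.
- by rewrite -[t.+1%:R]natr1; ring.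
- by lra.
Qed.

(** Case analysis on the distinct literals. One literal, or two of the same sign on distinct
    variables, need the exact computations above; all other cases have enough slack for
    [freq_bound]. *)
Lemma mean_unsat_le (C : clause n) :
  C != [::] -> mean (fun y => ~~ clause_sat y C) <= 1 - sat_goal R F C.
Proof.
move=> C_neq0; have s_gt := sqrt2_gt R; have s_lt := sqrt2_lt R.
have s_sq := sqrt2_sqr R.
have D_neq0 : undup C != [::] by apply: contraNneq C_neq0 => /undup_nil ->.
rewrite /sat_goal /clause_weight.
have unsatE y : ~~ clause_sat y C = all_false (undup C) y.
  by rewrite clause_sat_undup -all_predC.
apply: (@le_trans _ _ (mean (all_false (undup C)))).
  by apply: le_mean => y; rewrite unsatE.
(* With complementary literals C is always satisfied, and its goal is at most 1 because not all of
   its literals are positive. *)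
have [/hasP[l l_D nl_D]|] := boolP (has (fun l => (l.1, ~~ l.2) \in undup C) (undup C)).
  have mean0 : mean (fun=> false) = 0.
    by rewrite /mean !mean_at_const //= !mulr0 addr0.
  apply: (@le_trans _ _ 0).
    rewrite -mean0; apply: le_mean => y /allP false_y.
    have := false_y _ l_D; have := false_y _ nl_D; rewrite /lit_true /=.
    by case: (y l.1) (l.2) => [] [].
  have : (count (lit_true (majority F)) (undup C) < size (undup C))%N.
    rewrite ltn_neqAle count_size andbT -all_count; apply/negP => /allP true_D.
    have := true_D _ l_D; have := true_D _ nl_D; rewrite /lit_true /=.
    by case: (majority F l.1) (l.2) => [] [].
  have : (1 < size (undup C))%N.
    have := uniq_leq_size (s1 := [:: l; (l.1, ~~ l.2)]) (s2 := undup C); apply.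
      by rewrite /= inE andbT; case: l {l_D nl_D} => i []; rewrite xpair_eqE eqxx.
    by move=> l'; rewrite !inE => /pred2P[] ->.
  case: (size _) => [|[|[|[|j]]]] //= _; rewrite ?nth_nil; last by lra.
    by case: (count _ _) => [|[|]] //= _; lra.
  by case: (count _ _) => [|[|[|]]] //= _; lra.
move=> /hasPn cons; have := undup_uniq C; move: cons D_neq0; set D := undup C => cons D_neq0 uniq_D.
have {}uniq_D : uniq (map fst D).
  rewrite map_inj_in_uniq // => -[i b] [j c] /cons /= nD jD /= ij.
  by move: nD; rewrite ij; case: b c jD => [] [] // ->.
case: D D_neq0 uniq_D {cons} => [//|l1 [|l2 [|l3 [|l4 D]]]] _ uniq_D.
- rewrite mean_all_false1 /= addn0; case: (lit_true _ _) => /=; lra.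
- have [same|diff] := eqVneq (lit_true (majority F) l1) (lit_true (majority F) l2).
    apply: le_trans (mean_all_false2 _ same) _.
      by move: uniq_D; rewrite /= inE => /andP[].
    by rewrite /= addn0 -same expr2; case: (lit_true _ _) => /=; nra.
  apply: le_trans (mean_all_false_le _ _) _ => //.
  rewrite !big_cons big_nil /= addn0 /freq_bound.
  by move: diff; case: (lit_true _ l1) (lit_true _ l2) => [] [] //= _; lra.
- apply: le_trans (mean_all_false_le _ _) _ => //.
  rewrite !big_cons big_nil /= addn0 /freq_bound.
  by case: (lit_true _ l1) (lit_true _ l2) (lit_true _ l3) => [] [] [] /=; lra.
- rewrite /= nth_nil mul0r mulr0 mul0r addr0.
  (* The weight is 0, so the goal is just sqrt 2 / 2, and the first four literals suffice. *)
  apply: (@le_trans _ _ (mean (all_false [:: l1; l2; l3; l4]))).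
    by apply: le_mean => y; rewrite /all_false /= => /and5P[-> -> -> ->].
  apply: le_trans (mean_all_false_le _ _) _ => //.
    by have := take_uniq 4 uniq_D; rewrite /= take0.
  have : \prod_(l <- [:: l1; l2; l3; l4]) freq_bound l <= \prod_(l <- [:: l1; l2; l3; l4]) (5 / 7).
    by apply: ler_prod => l _; rewrite /freq_bound; case: ifP => _; lra.
  by rewrite [leRHS]big_const_seq /=; lra.
Qed.

End Rounding.

(** * From the mixture to the best seed *)

Section Approximation.

Variables (R : rcfType) (n : nat) (F : cnf n) (q : nat).
Hypotheses (q_prime : prime q) (lt_nq : n < q) (q_gt : 256 < q).

Local Open Scope ring_scope.

(** The mixture as one measure on a finite type, as [averaging] requires; constant lines get weight
    0. *)
Definition seed_weight (x : {ffun 'I_4 -> 'F_q} + {ffun 'I_2 -> 'F_q}) : R :=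
  match x with
  | inl _ => 49 / 50 / q%:R ^+ 4
  | inr c => 1 / 50 / (q%:R * (q%:R - 1)) * (c ord_max != 0)%:R
  end.

Definition seed_assignment (t : nat) (x : {ffun 'I_4 -> 'F_q} + {ffun 'I_2 -> 'F_q}) :=
  match x with
  | inl c => poly_assignment F t c
  | inr c => poly_assignment F t c
  end.

Lemma seed_weight_ge0 x : 0 <= seed_weight x.
Proof.
have q_gt' : 256 < q%:R :> R := Q_gt R q_gt.
case: x => c /=; first by rewrite divr_ge0 ?exprn_ge0; lra.
by rewrite mulr_ge0 ?ler0n // divr_ge0 ?mulr_ge0; lra.
Qed.

Lemma sum_seed_weight t (P : pred (assignment n)) :
  \sum_x seed_weight x * (P (seed_assignment t x))%:R = mean_at R F q t P.
Proof.
have sum_card (T : finType) (p : pred T) : \sum_x (p x)%:R = #|[set x | p x]|%:R :> R.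
  by rewrite -natr_sum -sum1_card [in RHS]big_mkcond; congr _%:R;
    apply: eq_bigr => x _; rewrite inE; case: (p x).
rewrite big_sumType /= /mean_at; congr (_ + _).
  by rewrite -mulr_sumr sum_card mulrAC -mulrA.
under eq_bigr do rewrite -(mulrA (1 / 50 / _)) -natrM mulnb.
by rewrite -mulr_sumr sum_card mulrAC -mulrA.
Qed.

Lemma Fp_ltn (v : 'F_q) : (v < q)%N.
Proof. by rewrite -[X in (_ < X)%N](Fp_cast q_prime). Qed.

Lemma hash_assignment_approx (B : nat) :
  (forall t c0 c1 c2 c3, [/\ t <= q, c0 < q, c1 < q, c2 < q & c3 < q]%N ->
     (nsat (hash_assignment F q t c0 c1 c2 c3) F <= B)%N) ->
  Num.sqrt 2 / 2 * (max_sat F)%:R <= B%:R :> R.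
Proof.
move=> nsat_le; have s_gt := sqrt2_gt R; have s_lt := sqrt2_lt R.
have q_gt' : 256 < q%:R :> R := Q_gt R q_gt.
have [|t lt_tq t_floor] := @nat_floor_exists R (sqrt2 R / 2 * q%:R) q.
  have : sqrt2 R * q%:R <= 99 / 70 * q%:R by rewrite ler_wpM2r; lra.
  have : 0 <= sqrt2 R * q%:R by rewrite mulr_ge0; lra.
  lra.
pose theta : R := sqrt2 R / 2 * q%:R - t%:R.
have [th0 th1] : 0 <= theta /\ theta <= 1.
  by move: t_floor; rewrite /theta -[t.+1%:R]natr1; split; lra.
(* The Boolean chooses between the thresholds t + 1 and t. *)
pose mu (i : bool * _) : R := (if i.1 then theta else 1 - theta) * seed_weight i.2.
pose X (i : bool * _) := seed_assignment (if i.1 then t.+1 else t) i.2.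
have sumE (P : pred (assignment n)) : \sum_i mu i * (P (X i))%:R = mean R F q t P.
  rewrite -(pair_bigA _ (fun b x => mu (b, x) * (P (X (b, x)))%:R)) /= big_bool /=.
  by rewrite addrC /mean -!sum_seed_weight !mulr_sumr; congr (_ + _);
    apply: eq_bigr => x _; rewrite mulrA.
have mean_const b : mean R F q t (fun=> b) = b%:R.
  by rewrite /mean !mean_at_const // -mulrDl subrK mul1r.
apply: (@averaging R n F _ mu X) => //.
- move=> [b x]; rewrite mulr_ge0 ?seed_weight_ge0 //; case: b => /=; lra.
- by rewrite -[LHS](eq_bigr _ (fun i _ => mulr1 (mu i))) (sumE predT) mean_const.
- move=> C C_F C_neq0; rewrite (sumE (fun y => clause_sat y C)).
  have := mean_unsat_le F q_prime lt_nq q_gt lt_tq t_floor C_neq0.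
  rewrite /mean ![mean_at _ _ _ _ (fun y => clause_sat y C)]mean_atC //.
  lra.
move=> [b [c|c]]; rewrite /X /= ?poly_assignment_cubic ?poly_assignment_linear //;
  apply: nsat_le; split; rewrite ?Fp_ltn ?prime_gt0 //; case: b => //; exact: ltnW.
Qed.

End Approximation.

(** * The search program *)

(** Booleans are 0 and 1, and truncated subtraction serves as the test for zero. *)
Definition not_e a := Op Defs.Sub (Cst 1) a.
Definition pos_e a := not_e (not_e a).
Definition eq_e a b := not_e (Op Add (Op Defs.Sub a b) (Op Defs.Sub b a)).
Definition lt_e a b := pos_e (Op Defs.Sub b a).

Definition vars_e := Inp (Cst 0).
Definition clauses_e := Inp (Cst 1).

(* Arguments j, v, i, s are the indices of the variables holding a clause
   number, a literal code, a variable number and a seed. *)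
Definition offset_e j := Acc (Var j) (Op Add (Inp (Op Add (Var 1) (Cst 2))) (Cst 1)).
Definition length_e j := Inp (Op Add (offset_e j) (Cst 2)).
Definition literal_e j a := Inp (Op Add (offset_e j) (Op Add (Var a) (Cst 3))).
(** Indices shift by two under [Acc], for the counter and the total, and by one under [Let]. *)
Definition mem_e j v := pos_e (Acc (length_e j) (eq_e (literal_e j.+2 0) (Var v.+2))).
(** Running over all 2n literal codes counts repeated literals once without storing the clause. *)
Definition distinct_e j := Acc (Op Add vars_e vars_e) (mem_e j.+2 0).
Definition weight_e j :=
  Let (distinct_e j)
    (Op Add (Op Mul (Cst 4) (eq_e (Var 0) (Cst 1)))
      (Op Add (Op Mul (Cst 2) (eq_e (Var 0) (Cst 2))) (eq_e (Var 0) (Cst 3)))).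
Definition bias_e v := Acc clauses_e (Op Mul (weight_e 0) (mem_e 0 v.+2)).
Definition majority_e i :=
  Let (Op Add (Var i) (Var i))
    (Let (Op Add (Var 0) (Cst 1)) (not_e (Op Defs.Sub (bias_e 1) (bias_e 0)))).

(** [prime_in_square] at n + 128 yields a prime q with 2n + 256 < q <= (2n + 256) ^ 2; the radix
    exceeds this by one, so every component of a seed is a digit. *)
Definition range_e := Op Add (Op Add vars_e vars_e) (Cst 256).
Definition radix_e := Op Add (Op Mul range_e range_e) (Cst 1).
Definition radix_pow_e k := iter k (Op Mul radix_e) (Cst 1).
Definition digit_e s k := Op Mod (Op Div (Var s) (radix_pow_e k)) radix_e.
Definition hash_e s i :=
  let horner a b := Op Add (Op Mul a (Var i)) b in
  Op Mod (horner (horner (horner (digit_e s 5) (digit_e s 4)) (digit_e s 3)) (digit_e s 2))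
    (digit_e s 0).
Definition value_e s i := eq_e (lt_e (hash_e s i) (digit_e s 1)) (majority_e i).

Definition sat_e s j :=
  pos_e (Acc (length_e j)
    (Let (literal_e j.+2 0)
      (Let (Op Div (Var 0) (Cst 2))
        (eq_e (value_e s.+4 0) (Op Mod (Var 1) (Cst 2)))))).
Definition count_e s := Acc clauses_e (sat_e s.+2 0).
(** The running total is the best seed so far; adding the difference replaces it by a strictly
    better one. The degree of a difference is that of its first operand, so the increment's degree
    does not grow with the total. *)
Definition best_e :=
  Acc (radix_pow_e 6)
    (Op Mul (Op Defs.Sub (Var 0) (Var 1)) (lt_e (count_e 1) (count_e 0))).

Definition radix (n : nat) : nat := (n + n + 256) * (n + n + 256) + 1.

Definition digit (n s k : nat) : nat := s %/ radix n ^ k %% radix n.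

Definition decode n (F : cnf n) (s : nat) : assignment n :=
  hash_assignment F (digit n s 0) (digit n s 1) (digit n s 2) (digit n s 3)
    (digit n s 4) (digit n s 5).

Lemma iteri_sum b f : iteri b (fun i acc => acc + f i) 0 = \sum_(i < b) f i.
Proof. by elim: b => [|b IH] /=; rewrite ?big_ord0 // big_ord_recr /= IH. Qed.

Lemma eval_not_e inp env a : eval inp env (not_e a) = (eval inp env a == 0).
Proof. by rewrite /=; case: (eval inp env a) => // k; rewrite subSS sub0n. Qed.

Lemma eval_pos_e inp env a : eval inp env (pos_e a) = (0 < eval inp env a).
Proof. by rewrite !eval_not_e; case: (eval inp env a). Qed.

Lemma eval_eq_e inp env a b :
  eval inp env (eq_e a b) = (eval inp env a == eval inp env b).
Proof. by rewrite eval_not_e /= addn_eq0 !subn_eq0 -eqn_leq. Qed.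

Lemma eval_lt_e inp env a b :
  eval inp env (lt_e a b) = (eval inp env a < eval inp env b).
Proof. by rewrite eval_pos_e /= subn_gt0. Qed.

(** * Semantics of the search program *)

Section Semantics.

Variables (n : nat) (F : cnf n).

Local Notation inp := (encode_cnf F).
Local Notation eval := (eval inp).

Definition literal_code (l : literal n) : nat := (val l.1).*2 + nat_of_bool l.2.

Lemma literal_code_inj : injective literal_code.
Proof.
move=> [i b] [j c]; rewrite /literal_code /= => eq_code.
have bc : b = c by have := congr1 odd eq_code; rewrite !oddD !odd_double !oddb.
by congr pair => //; apply: val_inj; move: eq_code; rewrite bc => /addIn/double_inj.
Qed.

Lemma literal_code_lt l : literal_code l < n + n.
Proof.
rewrite addnn /literal_code; have := ltn_ord l.1; rewrite -(leq_pmul2l (isT : 0 < 2)).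
by case: (l.2); rewrite -!muln2 /=; lia.
Qed.

Definition clause_offset (j : nat) : nat :=
  size (flatten [seq encode_clause C | C <- take j F]).

Lemma nth_input j b : j < size F -> b <= size (nth [::] F j) ->
  nth 0 inp (clause_offset j + b + 2) = nth 0 (encode_clause (nth [::] F j)) b.
Proof.
move=> j_lt b_le; rewrite /encode_cnf addn2 /= -[in X in nth 0 X](cat_take_drop j F).
rewrite (drop_nth [::]) // map_cat flatten_cat /= nth_cat ltnNge leq_addr /= addKn.
by case: b b_le => //= b b_lt; rewrite nth_cat size_map b_lt.
Qed.

Lemma nth_input_length j : j < size F -> nth 0 inp (clause_offset j + 2) = size (nth [::] F j).
Proof. by move=> j_lt; have := @nth_input j 0 j_lt isT; rewrite addn0. Qed.

Lemma clause_offsetS j : j < size F ->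
  clause_offset j.+1 = clause_offset j + (size (nth [::] F j) + 1).
Proof.
move=> j_lt; rewrite /clause_offset (take_nth [::]) // map_rcons flatten_rcons.
by rewrite size_cat /= size_map addn1.
Qed.

Lemma eval_offset_e env j : nth 0 env j <= size F ->
  eval env (offset_e j) = clause_offset (nth 0 env j).
Proof.
(* The running total, plus 2 for the input header, is the position at which the next clause length
   is read. *)
rewrite /=; elim: (nth 0 env j) => [|i IH] i_lt /=; first by rewrite /clause_offset take0.
by rewrite IH ?(ltnW i_lt) // nth_input_length // clause_offsetS.
Qed.

Lemma eval_length_e env j : nth 0 env j < size F ->
  eval env (length_e j) = size (nth [::] F (nth 0 env j)).
Proof.
move=> j_lt; rewrite -nth_input_length //.
by rewrite -(eval_offset_e (ltnW j_lt)).
Qed.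

Lemma eval_literal_e env j a : nth 0 env j < size F ->
  nth 0 env a < size (nth [::] F (nth 0 env j)) ->
  eval env (literal_e j a)
    = nth 0 (map literal_code (nth [::] F (nth 0 env j))) (nth 0 env a).
Proof.
move=> j_lt a_lt; set C := nth [::] F _.
rewrite -[RHS]/(nth 0 (encode_clause C) (nth 0 env a).+1).
rewrite -nth_input // -(eval_offset_e (ltnW j_lt)).
by rewrite -addn1 -!addnA.
Qed.

Lemma eval_acc env b e f :
  (forall i acc, i < eval env b -> eval [:: i, acc & env] e = f i) ->
  eval env (Acc b e) = \sum_(i < eval env b) f i.
Proof.
move=> eval_f; rewrite -iteri_sum /=; elim: (eval env b) eval_f => //= k IH eval_f.
by rewrite IH ?eval_f // => i acc i_lt; apply: eval_f; apply: ltnW.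
Qed.

Lemma sum_nth_pred (T : Type) (x0 : T) (p : pred T) (s : seq T) :
  \sum_(i < size s) p (nth x0 s i) = count p s.
Proof.
rewrite -sum1_count (big_nth x0) big_mkord [RHS]big_mkcond.
by apply: eq_bigr => i _; case: (p _).
Qed.

Lemma eval_mem_e env j v : nth 0 env j < size F ->
  eval env (mem_e j v) = (nth 0 env v \in map literal_code (nth [::] F (nth 0 env j))).
Proof.
move=> j_lt; rewrite eval_pos_e; set C := nth [::] F _.
rewrite (@eval_acc _ _ _ (fun i => nth 0 (map literal_code C) i == nth 0 env v)).
  rewrite eval_length_e // -/C -(size_map literal_code).
  by rewrite (sum_nth_pred 0 (pred1 (nth 0 env v))) -has_count has_pred1.
by move=> i acc; rewrite eval_length_e // => i_lt; rewrite eval_eq_e eval_literal_e.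
Qed.

Lemma sum_mem_iota (s : seq nat) b : all (fun v => v < b) s ->
  \sum_(v < b) (nat_of_ord v \in s) = size (undup s).
Proof.
move=> /allP lt_b; rewrite -(big_mkord xpredT (fun v => nat_of_bool (v \in s))).
transitivity (count [in s] (index_iota 0 b)).
  by rewrite -sum1_count [RHS]big_mkcond; apply: eq_bigr => v _; case: (v \in s).
rewrite -size_filter; apply: perm_size; apply: uniq_perm.
- by rewrite filter_uniq ?iota_uniq.
- exact: undup_uniq.
by move=> v; rewrite mem_filter mem_undup mem_index_iota; apply: andb_idr => /lt_b.
Qed.

Lemma eval_distinct_e env j : nth 0 env j < size F ->
  eval env (distinct_e j) = size (undup (nth [::] F (nth 0 env j))).
Proof.
move=> j_lt; set C := nth [::] F _.
rewrite (@eval_acc _ _ _ (fun v => v \in map literal_code C)).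
  rewrite sum_mem_iota; first by rewrite undup_map_inj ?size_map //; apply: literal_code_inj.
  by apply/allP => _ /mapP[l _ ->]; apply: literal_code_lt.
by move=> v acc _; rewrite eval_mem_e.
Qed.

Lemma eval_weight_e env j : nth 0 env j < size F ->
  eval env (weight_e j) = clause_weight (nth [::] F (nth 0 env j)).
Proof.
move=> j_lt; pose env1 := eval env (distinct_e j) :: env.
rewrite -[LHS]/(4 * eval env1 (eq_e (Var 0) (Cst 1)) + (2 * eval env1 (eq_e (Var 0) (Cst 2))
                 + eval env1 (eq_e (Var 0) (Cst 3)))).
rewrite !eval_eq_e [eval env1 (Var 0)]eval_distinct_e // /clause_weight.
by case: (size _) => [|[|[|[|k]]]] //=; rewrite nth_nil.
Qed.

Lemma eval_bias_e env v l : nth 0 env v = literal_code l -> eval env (bias_e v) = bias F l.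
Proof.
move=> vE; rewrite (@eval_acc _ _ _ (fun j => clause_weight (nth [::] F j) * (l \in nth [::] F j))).
  by rewrite /bias (big_nth [::]) big_mkord.
move=> j acc j_lt; have j_lt' : nth 0 [:: j, acc & env] 0 < size F by [].
rewrite -[LHS]/(eval [:: j, acc & env] (weight_e 0) * eval [:: j, acc & env] (mem_e 0 v.+2)).
by rewrite eval_weight_e // eval_mem_e // [nth _ _ v.+2]vE mem_map //; apply: literal_code_inj.
Qed.

Lemma eval_majority_e env i (x : 'I_n) : nth 0 env i = x ->
  eval env (majority_e i) = majority F x.
Proof.
move=> iE; set env2 := [:: x + x + 1, x + x & env].
transitivity (eval env2 (not_e (Op Defs.Sub (bias_e 1) (bias_e 0)))).
  by rewrite /env2 /majority_e -iE.
rewrite eval_not_e.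
rewrite -[eval env2 (Op _ _ _)]/(eval env2 (bias_e 1) - eval env2 (bias_e 0)).
rewrite (@eval_bias_e _ 1 (x, false)) ?(@eval_bias_e _ 0 (x, true)) //=.
- by rewrite subn_eq0 ffunE.
- by rewrite /literal_code /= addnn.
- by rewrite /literal_code /= addnn addn0.
Qed.

Lemma eval_radix_pow_e env k : eval env (radix_pow_e k) = radix n ^ k.
Proof. by elim: k => // k; rewrite expnS => <-. Qed.

Lemma eval_digit_e env s k : eval env (digit_e s k) = digit n (nth 0 env s) k.
Proof. by rewrite /digit -(eval_radix_pow_e env). Qed.

Lemma eval_value_e env s i (x : 'I_n) : nth 0 env i = x ->
  eval env (value_e s i) = decode F (nth 0 env s) x.
Proof.
move=> iE; rewrite eval_eq_e eval_lt_e (eval_majority_e iE) [decode _ _ _]ffunE eval_digit_e.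
rewrite /cubic_hash -iE -!(eval_digit_e env).
by case: (_ < _) (majority _ _) => [] [].
Qed.

Lemma eval_sat_e env s j : nth 0 env j < size F ->
  eval env (sat_e s j)
    = clause_sat (decode F (nth 0 env s)) (nth [::] F (nth 0 env j)).
Proof.
move=> j_lt; rewrite eval_pos_e; set C := nth [::] F _; set y := decode F _.
case C_eq : C => [|l0 C'].
  by rewrite (@eval_acc _ _ _ (fun=> 0)) eval_length_e // -/C C_eq //= big_ord0.
rewrite -C_eq (@eval_acc _ _ _ (fun i => lit_true y (nth l0 C i))).
  by rewrite eval_length_e // -/C (sum_nth_pred l0 (lit_true y)) -has_count.
move=> i acc; rewrite eval_length_e // -/C => i_lt; set l := nth l0 C i.
set env1 := [:: i, acc & env].
have litE : eval env1 (literal_e j.+2 0) = literal_code l.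
  by rewrite eval_literal_e // -/C (nth_map l0).
set env2 := [:: literal_code l %/ 2, literal_code l & env1].
transitivity (eval env2 (eq_e (value_e s.+4 0) (Op Mod (Var 1) (Cst 2)))).
  by rewrite /env2 -litE.
have codeE : literal_code l = l.1 * 2 + l.2 by rewrite /literal_code -muln2.
have div_code : literal_code l %/ 2 = l.1.
  by rewrite codeE divnMDl // divn_small ?addn0 //; case: (l.2).
rewrite eval_eq_e (@eval_value_e env2 s.+4 0 l.1) //=.
by rewrite codeE modnMDl /lit_true -/y; case: (y l.1) (l.2) => [] [].
Qed.

Lemma eval_count_e env s : eval env (count_e s) = nsat (decode F (nth 0 env s)) F.
Proof.
rewrite (@eval_acc _ _ _ (fun j => clause_sat (decode F (nth 0 env s)) (nth [::] F j))).
  by rewrite (sum_nth_pred [::] (clause_sat _)).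
by move=> j acc j_lt; rewrite (@eval_sat_e [:: j, acc & env]).
Qed.

Lemma best_e_max s : s < radix n ^ 6 ->
  nsat (decode F s) F <= nsat (decode F (eval [::] best_e)) F.
Proof.
pose score s := nsat (decode F s) F.
rewrite -/(score s) -/(score (eval [::] best_e)).
have -> : eval [::] best_e =
    iteri (radix n ^ 6) (fun i acc => acc + (i - acc) * (score acc < score i)) 0.
  rewrite -(eval_radix_pow_e [::] 6) /best_e.
  rewrite -[LHS]/(iteri (eval [::] (radix_pow_e 6)) (fun i acc => acc + (i - acc)
    * eval [:: i; acc] (lt_e (count_e 1) (count_e 0))) 0).
  by apply: eq_iteri => i acc; rewrite eval_lt_e !eval_count_e.
set step := fun i acc => _.
(* The first half makes the truncated difference k - b exact. *)
have best_le k : iteri k step 0 <= k /\ forall s', s' < k -> score s' <= score (iteri k step 0).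
  elim: k => [|k [IH1 IH2]] //=; set b := iteri k step 0 in IH1 IH2 *; rewrite /step.
  case: (ltnP (score b) (score k)) => [lt_b|le_k].
    rewrite muln1 subnKC //; split=> // s'; rewrite ltnS leq_eqVlt => /predU1P[->//|/IH2 le_b].
    exact: leq_trans le_b (ltnW lt_b).
  rewrite muln0 addn0; split; first exact: leqW.
  by move=> s'; rewrite ltnS leq_eqVlt => /predU1P[->//|/IH2].
by move=> /(proj2 (best_le _)).
Qed.

End Semantics.

Lemma best_e_approx (R : rcfType) n (F : cnf n) :
  (Num.sqrt 2 / 2 * (max_sat F)%:R
     <= (nsat (decode F (eval (encode_cnf F) [::] best_e)) F)%:R :> R)%R.
Proof.
have [|q q_prime /andP[q_gt q_le]] := @prime_in_square (n + 128); first by lia.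
have lt_nq : n < q by lia.
have q_gt256 : 256 < q by lia.
apply: (hash_assignment_approx R q_prime lt_nq q_gt256) => t c0 c1 c2 c3.
move=> [t_le c0_lt c1_lt c2_lt c3_lt].
set N := radix n.
have q_lt : q < N.
  by apply: leq_ltn_trans q_le _; rewrite /N /radix expnS expn1 -muln2; nia.
have N_gt0 : 0 < N by apply: leq_ltn_trans q_lt.
(* The seed with these six base N digits, in the order in which [decode] reads them. *)
pose s := q + N * (t + N * (c0 + N * (c1 + N * (c2 + N * c3)))).
have digit_lt d x : d < N -> (d + N * x) %% N = d.
  by move=> d_lt; rewrite addnC mulnC modnMDl modn_small.
have digit_shift d x : d < N -> (d + N * x) %/ N = x.
  by move=> d_lt; rewrite addnC mulnC divnMDl // divn_small ?addn0.
have decodeE : decode F s = hash_assignment F q t c0 c1 c2 c3.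
  rewrite /decode /digit -/N !expnS !expn0 !divnMA !divn1 ?muln1.
  rewrite /s !digit_shift ?digit_lt ?modn_small //; lia.
rewrite -decodeE; apply: best_e_max; rewrite -/N /s.
have lift_lt d x k : d < N -> x < N ^ k -> d + N * x < N ^ k.+1.
  by move=> d_lt x_lt; rewrite expnS; nia.
do 5!(apply: (lift_lt); first by lia).
by rewrite expn1; lia.
Qed.

Lemma encode_cnf_le r n (F : cnf n) X :
  width_le r F -> n + n <= X -> size F <= X -> r <= X ->
  forall i, nth 0 (encode_cnf F) i <= X.
Proof.
move=> /allP F_width n_le F_le r_le i.
have all_le : all (leq^~ X) (encode_cnf F).
  rewrite /= F_le (leq_trans (leq_addr n n) n_le) /=.
  apply/allP => v /flattenP[_ /mapP[C C_F ->]]; rewrite inE => /predU1P[->|/mapP[l _ ->]].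
    exact: leq_trans (F_width C C_F) r_le.
  by apply: leq_trans (ltnW (literal_code_lt l)) n_le.
have [i_lt|i_ge] := ltnP i (size (encode_cnf F)); first exact: (all_nthP 0 all_le).
by rewrite nth_default.
Qed.

Definition maxsat_program : program := output_program best_e vars_e (value_e 1 0).

Lemma maxsat_program_computes : exists K D T, forall inp X best,
  2 <= X -> (forall i, nth 0 inp i <= X) -> eval inp [::] best_e = best ->
  computes_within maxsat_program inp
    [seq eval inp [:: i; best] (value_e 1 0) != 0 | i <- iota 0 (eval inp [:: best] vars_e)]
    (X ^ T) (D * (trunc_log 2 (X ^ K)).+1).
Proof.
(* Generous bounds on the exponents of intermediate values and on the destination addresses in the
   program, both checked by computation. *)
exists (10 * 10 * 10), (10 * 10), (output_time best_e vars_e (value_e 1 0)).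
move=> inp X best X_ge2 inp_le <-.
have prog_ok : output_ok (10 * 10 * 10) best_e vars_e (value_e 1 0) by vm_compute.
have [p [m [run_P halt_P]]] := output_program_runs X_ge2 inp_le prog_ok.
by apply: runs_computes run_P halt_P _; vm_compute.
Qed.

(** Clauses may repeat, so the number of clauses is assumed to be n^O(r); for formulas without
    repetitions, [size_uniq_cnf] provides this with a = 3. *)
Theorem theorem2 (R : rcfType) :
  exists P : program, forall a : nat, exists c : nat,
  forall (r n : nat) (F : cnf n),
    0 < r ->
    width_le r F ->
    size F <= maxn n 2 ^ (a * r) ->
    exists x : assignment n,
      computes_within P (encode_cnf F) (encode_assignment x)
        (maxn n 2 ^ (c * r)) (c * r * up_log 2 (maxn n 2))
      /\ (Num.sqrt 2 / 2 * (max_sat F)%:R <= (nsat x F)%:R :> R)%R.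
Proof.
have [K [D [T run_P]]] := maxsat_program_computes.
exists maxsat_program => a.
(* The sum of the time exponent and the space factor serves both bounds. *)
exists ((a + 2) * T + D * ((a + 2) * K + 1)) => r n F r_gt0 F_width F_size.
set inp := encode_cnf F; set best := eval inp [::] best_e.
exists (decode F best); split; last exact: best_e_approx.
set N := maxn n 2 in F_size *.
have N_ge2 : 2 <= N by apply: leq_maxr.
have N_gt0 : 0 < N by apply: leq_trans N_ge2.
(* X bounds every input entry: literal codes are below 2n <= N ^ 2, there are at most N ^ (a r)
   clauses, and clause lengths are at most r <= N ^ r. *)
pose X := N ^ ((a + 2) * r).
have le_X k : k <= (a + 2) * r -> N ^ k <= X by move=> k_le; rewrite leq_pexp2l.
have X_ge2 : 2 <= X by apply: leq_trans N_ge2 _; rewrite -[leqLHS]expn1 le_X //; nia.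
have inp_le i : nth 0 inp i <= X.
  apply: (encode_cnf_le F_width).
  - apply: (@leq_trans (N ^ 2)); last by apply: le_X; nia.
    by rewrite addnn -mul2n expnS expn1 leq_mul // leq_maxl.
  - by apply: leq_trans F_size _; apply: le_X; nia.
  - apply: leq_trans (ltnW (ltn_expl r (ltnSn 1))) _.
    by apply: (@leq_trans (N ^ r)); [rewrite leq_exp2r | apply: le_X; nia].
have {run_P} := run_P inp X best X_ge2 inp_le erefl.
have out_eq : [seq eval inp [:: i; best] (value_e 1 0) != 0
    | i <- iota 0 (eval inp [:: best] vars_e)] = encode_assignment (decode F best).
  rewrite -[eval _ _ vars_e]/n -val_enum_ord -map_comp; apply: eq_map => i.
  have valE : eval inp [:: val i; best] (value_e 1 0) = decode F best i.
    exact: (@eval_value_e n F [:: val i; best] 1 0 i erefl).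
  rewrite -[LHS]/(eval inp [:: val i; best] (value_e 1 0) != 0) valE.
  by case: (decode F best i).
rewrite out_eq => -[t [t_le halt_t out_t space_t]].
exists t; split=> //.
  apply: leq_trans t_le _; rewrite -expnM leq_pexp2l // mulnAC leq_mul2r.
  by rewrite leq_addr orbT.
move=> s s_le; apply: leq_trans (space_t s s_le) _.
set u := up_log 2 N.
have u_gt0 : 0 < u by rewrite up_log_gt0.
have log_le : trunc_log 2 (X ^ K) <= u * ((a + 2) * r * K).
  rewrite -(@leq_exp2l 2) //; apply: leq_trans (trunc_logP _ _) _ => //.
    by rewrite expn_gt0 ltnW.
  rewrite -expnM [leqRHS]expnM; case: (_ * K) => // e.
  by rewrite leq_exp2r ?up_logP.
(* The extra bit per cell is absorbed since r u >= 1. *)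
apply: (@leq_trans (D * ((a + 2) * K + 1) * r * u)); last first.
  by rewrite leq_mul2r leq_mul2r leq_addl !orbT.
rewrite -!mulnA leq_mul2l; apply/orP; right.
by apply: leq_ltn_trans log_le _; nia.
Qed.
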